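(* In any convex resource theory, with free sets $\mathcal F$ on the input space and $\mathcal F'$ on the output space, for states $\rho$ (input) and $\rho'$ (output) there exists a resource--non-generating probabilistic transformation $\rho\to\rho'$ if any of the following holds: (i) $\infty>\Omega_{\mathcal F}(\rho)\ge\Omega^{\mathcal F'}_{\mathcal F'}(\rho')$; (ii) $\Omega_{\mathcal F}(\rho)=\infty$ and $R^{\mathcal F'}_{\mathcal F'}(\rho')<\infty$; (iii) $R_{\mathcal F}(\rho)=\infty$.
   Context: Finite dimensions; $A\le B$ means $B-A\ge0$. Each space carries a closed convex set $\mathcal F$ of free density operators; $\mathrm{cone}(\mathcal F)=\{\lambda\sigma:\lambda\ge0,\sigma\in\mathcal F\}$, $A\le_{\mathcal F}B$ means $B-A\in\mathrm{cone}(\mathcal F)$. $R_{\max}(X\|Y)=\inf\{\lambda:X\le\lambda Y\}$, $R^{\mathcal F}_{\max}(X\|Y)=\inf\{\lambda:X\le_{\mathcal F}\lambda Y\}$, $\inf\emptyset=\infty$. $R_{\mathcal F}(\rho)=\min_{\sigma\in\mathcal F}R_{\max}(\rho\|\sigma)$, $R^{\mathcal F}_{\mathcal F}(\rho)=\min_{\sigma\in\mathcal F}R^{\mathcal F}_{\max}(\rho\|\sigma)$, $\Omega_{\mathcal F}(\rho)=\inf_{\sigma\in\mathcal F}R_{\max}(\rho\|\sigma)R_{\max}(\sigma\|\rho)$, $\Omega^{\mathcal F}_{\mathcal F}(\rho)=\inf_{\sigma\in\mathcal F}R^{\mathcal F}_{\max}(\rho\|\sigma)R_{\max}(\sigma\|\rho)$.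 $\mathbb O$ is the set of completely positive trace-non-increasing maps $\mathcal E$ such that for every $\sigma\in\mathcal F$ there exist $\sigma'\in\mathcal F'$ and $p\in[0,1]$ with $\mathcal E(\sigma)=p\sigma'$. A probabilistic transformation $\rho\to\rho'$ exists iff $\rho'$ lies in the closure of $\{\mathcal E(\rho)/\mathrm{Tr}\,\mathcal E(\rho):\mathcal E\in\mathbb O,\ \mathrm{Tr}\,\mathcal E(\rho)>0\}$. *)

(* Defs.v *)
From HB Require Import structures.
From mathcomp Require Import all_boot all_order all_algebra.
From mathcomp Require Import complex.
From mathcomp Require Import all_classical all_reals.
From mathcomp Require Import ereal.

Set Implicit Arguments.
Unset Strict Implicit.
Unset Printing Implicit Defensive.

Import Order.TTheory GRing.Theory Num.Theory.
Local Open Scope ring_scope.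
Local Open Scope classical_set_scope.

Section QRT.
Variable R : realType.
Local Notation C := (R[i]).

(* Complex order on R[i]: z <= w iff Im z = Im w and Re z <= Re w. *)

Definition psd n (A : 'M[C]_n) : Prop :=
  forall v : 'I_n -> C,
    0 <= \sum_(i < n) \sum_(j < n) (v i)^* * A i j * v j.

Definition loewner_le n (A B : 'M[C]_n) : Prop := psd (B - A).

Definition density n (rho : 'M[C]_n) : Prop := psd rho /\ \tr rho = 1.

(** Positive semidefiniteness of an operator on C^k (x) C^n, given by its
    k x k array of n x n blocks X a b. *)
Definition block_psd k n (X : 'I_k -> 'I_k -> 'M[C]_n) : Prop :=
  forall v : 'I_k -> 'I_n -> C,
    0 <= \sum_(a < k) \sum_(b < k) \sum_(i < n) \sum_(j < n)
            (v a i)^* * X a b i j * v b j.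

Definition completely_positive n m (E : {linear 'M[C]_n -> 'M[C]_m}) : Prop :=
  forall k (X : 'I_k -> 'I_k -> 'M[C]_n),
    block_psd X -> block_psd (fun a b => E (X a b)).

Definition trace_nonincreasing n m (E : 'M[C]_n -> 'M[C]_m) : Prop :=
  forall X, psd X -> \tr (E X) <= \tr X.

(** Entrywise distance < eps (all norms on a finite-dimensional space are
    equivalent, so this defines the usual topology). *)
Definition mx_close n (A B : 'M[C]_n) (eps : R) : Prop :=
  forall i j, `|A i j - B i j| < (real_complex R eps).

Definition closed_mx_set n (S : set 'M[C]_n) : Prop :=
  forall X, (forall eps : R, 0 < eps -> exists2 Y, S Y & mx_close X Y eps) ->
    S X.

Definition convex_mx_set n (S : set 'M[C]_n) : Prop :=
  forall X Y (t : R), S X -> S Y -> 0 <= t <= 1 ->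
    S ((real_complex R t) *: X + (real_complex R (1 - t)) *: Y).

Definition free_set n (F : set 'M[C]_n) : Prop :=
  [/\ F !=set0, (forall s, F s -> density s), closed_mx_set F & convex_mx_set F].

Definition cone n (F : set 'M[C]_n) : set 'M[C]_n :=
  [set X | exists mu : R, exists2 s, F s & 0 <= mu /\ X = (real_complex R mu) *: s].

Definition F_le n (F : set 'M[C]_n) (A B : 'M[C]_n) : Prop := cone F (B - A).

Definition Rmax n (X Y : 'M[C]_n) : \bar R :=
  ereal_inf [set (l%:E) | l in [set l : R | loewner_le X ((real_complex R l) *: Y)]].

Definition RmaxF n (F : set 'M[C]_n) (X Y : 'M[C]_n) : \bar R :=
  ereal_inf [set (l%:E) | l in [set l : R | F_le F X ((real_complex R l) *: Y)]].

Definition R_F n (F : set 'M[C]_n) (rho : 'M[C]_n) : \bar R :=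
  ereal_inf [set Rmax rho s | s in F].

Definition R_FF n (F : set 'M[C]_n) (rho : 'M[C]_n) : \bar R :=
  ereal_inf [set RmaxF F rho s | s in F].

Definition Omega_F n (F : set 'M[C]_n) (rho : 'M[C]_n) : \bar R :=
  ereal_inf [set (Rmax rho s * Rmax s rho)%E | s in F].

Definition Omega_FF n (F : set 'M[C]_n) (rho : 'M[C]_n) : \bar R :=
  ereal_inf [set (RmaxF F rho s * Rmax s rho)%E | s in F].

Definition RNG n m (F : set 'M[C]_n) (F' : set 'M[C]_m)
    (E : {linear 'M[C]_n -> 'M[C]_m}) : Prop :=
  [/\ completely_positive E, trace_nonincreasing E &
      forall s, F s -> exists s', exists p : R,
        [/\ F' s', 0 <= p <= 1 & E s = (real_complex R p) *: s']].

(** Existence of a probabilistic transformation rho -> rho' : rho' lies in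
    the closure of the set of normalized outputs E(rho)/Tr E(rho). *)
Definition prob_transformation n m (F : set 'M[C]_n) (F' : set 'M[C]_m)
    (rho : 'M[C]_n) (rho' : 'M[C]_m) : Prop :=
  forall eps : R, 0 < eps ->
    exists E : {linear 'M[C]_n -> 'M[C]_m},
      [/\ RNG F F' E, 0 < \tr (E rho) &
          mx_close ((\tr (E rho))^-1 *: E rho) rho' eps].

End QRT.

(* Main.v *)
(** For [w < Omega_F F rho] the pair [(rho, - w rho)] is at positive distance
    from the cone of all [(s - S, - s - T)] with [s] in [cone F] and [S], [T]
    positive semidefinite: otherwise compactness of [F] would give a free state
    with [rho <= t s <= w rho].  Separation yields effects [A], [B] with
    [tr (A s) <= tr (B s)] on [F] and [tr (A rho) = w * tr (B rho) > 0].  The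
    measure-and-prepare map [X |-> tr (A X) P + tr (B X) Q] with
    [P = rho' - sigma' / mu] (or [P = rho'] when [Omega_F F rho] is infinite) and
    [Q = l sigma' - rho'] in [cone F'] sends free states to [cone F'] and [rho] to
    a multiple of [(w - 1) rho' + (l - w / mu) sigma'], whose second term becomes
    negligible for [w] close to [Omega_F F rho].  If [R_F F rho] is infinite, some
    vector [v] is annihilated by every free state but not by [rho], and
    [X |-> tr (v v* X) rho'] kills all free states. *)

Require Import Defs.
From HB Require Import structures.
From mathcomp Require Import all_boot all_order all_algebra.
From mathcomp Require Import complex.
From mathcomp Require Import all_classical all_reals.
From mathcomp Require Import ereal.
From mathcomp Require Import sesquilinear spectral topology normedtype ring lra.

Set Implicit Arguments.
Unset Strict Implicit.
Unset Printing Implicit Defensive.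

Import Order.TTheory GRing.Theory Num.Theory numFieldNormedType.Exports.
Local Open Scope ring_scope.
Local Open Scope classical_set_scope.
Local Open Scope sesquilinear_scope.

(** * Positive semidefinite matrices: Gram factors, trace bounds, domination *)

Section PositiveSemidefinite.
Variable R : realType.
Local Notation C := (R[i]).
Local Notation "x %:C" := (real_complex R x) (format "x %:C").

Definition sform m n (A : 'M[C]_(m, n)) (u : 'cV[C]_m) (v : 'cV[C]_n) : C :=
  (u ^t* *m A *m v) 0 0.

Lemma sformE m n (A : 'M[C]_(m, n)) u v :
  sform A u v = \sum_(i < m) \sum_(j < n) (u i 0)^* * A i j * v j 0.
Proof.
rewrite /sform !mxE exchange_big /=; apply: eq_bigr => j _.
by rewrite !mxE mulr_suml; apply: eq_bigr => i _; rewrite !mxE.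
Qed.

Lemma psdP n (A : 'M[C]_n) : psd A <-> forall v, 0 <= sform A v v.
Proof.
split=> [hA v|hA v]; first by rewrite sformE; exact: hA.
have := hA (\col_i v i); rewrite sformE.
by under eq_bigr => i _ do under eq_bigr => j _ do rewrite !mxE.
Qed.

Lemma sformDl m n (A : 'M[C]_(m, n)) u u' v :
  sform A (u + u') v = sform A u v + sform A u' v.
Proof.
rewrite !sformE -big_split; apply: eq_bigr => i _ /=.
by rewrite -big_split; apply: eq_bigr => j _; rewrite /= !mxE rmorphD /= !mulrDl.
Qed.

Lemma sformDr m n (A : 'M[C]_(m, n)) u v v' :
  sform A u (v + v') = sform A u v + sform A u v'.
Proof. by rewrite /sform mulmxDr mxE. Qed.

Lemma sformZl m n (A : 'M[C]_(m, n)) c u v :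
  sform A (c *: u) v = c^* * sform A u v.
Proof.
rewrite !sformE mulr_sumr; apply: eq_bigr => i _ /=.
by rewrite mulr_sumr; apply: eq_bigr => j _; rewrite !mxE rmorphM /= !mulrA.
Qed.

Lemma sformZr m n (A : 'M[C]_(m, n)) c u v :
  sform A u (c *: v) = c * sform A u v.
Proof. by rewrite /sform -scalemxAr mxE. Qed.

Lemma sform_delta m n (A : 'M[C]_(m, n)) i j :
  sform A (delta_mx i 0) (delta_mx j 0) = A i j.
Proof.
rewrite sformE (bigD1 i) //= (bigD1 j) //= !mxE !eqxx /= conjC1 mul1r mulr1.
rewrite !big1 ?addr0 // => [k ki|k ki]; first rewrite big1 // => l _.
  by rewrite !mxE (negPf ki) /= conjC0 !mul0r.
by rewrite !mxE (negPf ki) mulr0.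
Qed.

Lemma sformD m n (A B : 'M[C]_(m, n)) u v :
  sform (A + B) u v = sform A u v + sform B u v.
Proof. by rewrite /sform mulmxDr mulmxDl mxE. Qed.

Lemma sformZ m n c (A : 'M[C]_(m, n)) u v :
  sform (c *: A) u v = c * sform A u v.
Proof. by rewrite /sform -scalemxAr -scalemxAl mxE. Qed.

Lemma sformB m n (A B : 'M[C]_(m, n)) u v :
  sform (A - B) u v = sform A u v - sform B u v.
Proof. by rewrite -scaleN1r sformD sformZ mulN1r. Qed.

Lemma sform_adj m n (A : 'M[C]_(m, n)) u v :
  sform (A ^t* ) v u = (sform A u v)^*.
Proof.
rewrite !sformE exchange_big /= rmorph_sum; apply: eq_bigr => i _ /=.
rewrite rmorph_sum; apply: eq_bigr => j _; rewrite !mxE /= !rmorphM /= conjCK.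
by rewrite mulrC mulrA mulrAC.
Qed.

Lemma sform_tr m n (A : 'M[C]_(m, n)) u v : sform A u v = \tr (A *m (v *m u ^t* )).
Proof. by rewrite mulmxA mxtrace_mulC mulmxA trace_mx11. Qed.

(* Polarization: over the complex numbers the diagonal of a sesquilinear form
   determines the form. *)
Lemma sform_diag_eq0 n (A : 'M[C]_n) : (forall v, sform A v v = 0) -> A = 0.
Proof.
move=> hA; apply/matrixP => i j; rewrite [RHS]mxE.
have H c : c * A i j + c^* * A j i = 0.
  have := hA (delta_mx i 0 + c *: delta_mx j 0).
  rewrite !(sformDl, sformDr, sformZl, sformZr) !hA !sform_delta.
  by rewrite !(mulr0, add0r, addr0) addrC.
have h1 := H 1; have h2 := H 'i.
have i0 : ('i : C) != 0 by rewrite neq0Ci.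
rewrite conjC1 !mul1r in h1; rewrite conjCi mulNr -mulrBr in h2.
move/eqP: h2; rewrite mulf_eq0 (negPf i0) /= subr_eq0 => /eqP e.
move/eqP: h1; rewrite -e -mulr2n mulrn_eq0 /= => /eqP ->; by [].
Qed.

Lemma psd_adj n (A : 'M[C]_n) : psd A -> A ^t* = A.
Proof.
move/psdP => hA; apply/eqP; rewrite -subr_eq0; apply/eqP.
apply: sform_diag_eq0 => v; rewrite sformB sform_adj.
by rewrite (CrealP _) ?subrr // ger0_real.
Qed.

Lemma psdD n (A B : 'M[C]_n) : psd A -> psd B -> psd (A + B).
Proof.
by move=> /psdP hA /psdP hB; apply/psdP => v; rewrite sformD addr_ge0.
Qed.

Lemma psdZ n (c : C) (A : 'M[C]_n) : 0 <= c -> psd A -> psd (c *: A).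
Proof.
by move=> c0 /psdP hA; apply/psdP => v; rewrite sformZ mulr_ge0.
Qed.

Lemma psd0 n : psd (0 : 'M[C]_n).
Proof. by apply/psdP => v; rewrite /sform mulmx0 mul0mx mxE. Qed.

Lemma adjM m n p (A : 'M[C]_(m, n)) (B : 'M[C]_(n, p)) :
  (A *m B) ^t* = B ^t* *m A ^t*.
Proof. by rewrite trmx_mul map_mxM. Qed.

Lemma sform_gram k n (B : 'M[C]_(k, n)) v :
  sform (B ^t* *m B) v v = \sum_(i < k) `|(B *m v) i 0| ^+ 2.
Proof.
rewrite /sform mulmxA -adjM -mulmxA mxE; apply: eq_bigr => i _.
by rewrite !mxE normCK mulrC.
Qed.

Lemma psd_gram k n (B : 'M[C]_(k, n)) : psd (B ^t* *m B).
Proof.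
by apply/psdP => v; rewrite sform_gram sumr_ge0 // => i _; rewrite exprn_ge0.
Qed.

Lemma psd_outer k n (B : 'M[C]_(n, k)) : psd (B *m B ^t* ).
Proof. by rewrite -{1}[B]trmxCK; exact: psd_gram. Qed.

Lemma psd1 n : psd (1%:M : 'M[C]_n).
Proof.
by have := psd_gram (1%:M : 'M[C]_n); rewrite mulmx1 trmx1 map_mx1.
Qed.

(** The spectral theorem diagonalizes [A] in a unitary basis; [B] is that change of basis followed
    by the square roots of the eigenvalues. Later positivity arguments go through such factors,
    which turn forms and traces into sums of squared moduli. *)
Lemma psd_gramP n (A : 'M[C]_n) : psd A -> exists B : 'M[C]_n, A = B ^t* *m B.
Proof.
move=> hA; have hadj := psd_adj hA.
have /hermitian_normalmx/orthomx_spectralP eA : A \is hermsymmx.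
  by apply/is_hermitianmxP; rewrite expr0 scale1r hadj.
set P := spectralmx A in eA; set d := spectral_diag A in eA.
have uP : P \is unitarymx by exact: spectral_unitarymx.
rewrite (invmx_unitary uP) in eA.
have PP : P *m P ^t* = 1%:M by apply/unitarymxP.
have eD : P *m A *m P ^t* = diag_mx d.
  by rewrite {1}eA !mulmxA PP mul1mx -mulmxA PP mulmx1.
(* An eigenvalue is the value of the form of [A] at the matching column of the adjoint of [P]. *)
have d_ge0 i : 0 <= d 0 i.
  have /psdP/(_ (P ^t* *m delta_mx i 0)) := hA.
  rewrite /sform adjM trmxCK !mulmxA -(mulmxA _ P A) -(mulmxA _ (P *m A)) eD.
  by rewrite -/(sform _ _ _) sform_delta mxE eqxx mulr1n.
pose s := map_mx sqrtC d.
exists (diag_mx s *m P).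
have -> : (diag_mx s *m P) ^t* = P ^t* *m diag_mx s.
  rewrite adjM; congr (_ *m _); apply/matrixP => i j; rewrite !mxE.
  rewrite eq_sym; case: eqP => [->|_]; last by rewrite mulr0n conjC0.
  by rewrite !mulr1n (CrealP _) // ger0_real // sqrtC_ge0.
rewrite mulmxA -(mulmxA (P ^t* )) mulmx_diag {1}eA.
suff -> : (\row_j (s 0 j * s 0 j)) = d by [].
by apply/rowP => i; rewrite !mxE -expr2 sqrtCK.
Qed.

Lemma trmx_gram k n (B : 'M[C]_(k, n)) :
  \tr (B ^t* *m B) = \sum_(i < k) \sum_(j < n) `|B i j| ^+ 2.
Proof.
rewrite /mxtrace exchange_big; apply: eq_bigr => j _ /=.
by rewrite !mxE; apply: eq_bigr => i _; rewrite !mxE normCK mulrC.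
Qed.

Lemma psd_tr_ge0 n (A : 'M[C]_n) : psd A -> 0 <= \tr A.
Proof.
move=> /psd_gramP[B ->]; rewrite trmx_gram.
by apply: sumr_ge0 => i _; apply: sumr_ge0 => j _; rewrite exprn_ge0.
Qed.

(** With Gram factors [a] and [b], cyclicity turns the trace into that of the Gram matrix of [a]
    times the adjoint of [b]. *)
Lemma psd_tr_mul_ge0 n (A B : 'M[C]_n) : psd A -> psd B -> 0 <= \tr (A *m B).
Proof.
move=> /psd_gramP[a ->] /psd_gramP[b ->].
rewrite mulmxA mxtrace_mulC !mulmxA -mulmxA.
have -> : b *m a ^t* = (a *m b ^t* ) ^t* by rewrite adjM trmxCK.
exact/psd_tr_ge0/psd_gram.
Qed.

Lemma psd_diag_ge0 n (A : 'M[C]_n) i : psd A -> 0 <= A i i.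
Proof. by move=> /psdP /(_ (delta_mx i 0)); rewrite sform_delta. Qed.

Lemma psd_entry_le n (A : 'M[C]_n) i j : psd A -> `|A i j| <= \tr A.
Proof.
move=> hA; have [eij|nij] := eqVneq i j.
  subst j; rewrite ger0_norm ?psd_diag_ge0 // /mxtrace (bigD1 i) //= lerDl.
  by apply: sumr_ge0 => k _; exact: psd_diag_ge0.
have tr2 : A i i + A j j <= \tr A.
  rewrite /mxtrace (bigD1 i) //= (bigD1 j) 1?eq_sym //= addrA lerDl.
  by apply: sumr_ge0 => k _; exact: psd_diag_ge0.
have [->|a0] := eqVneq (A i j) 0; first by rewrite normr0 psd_tr_ge0.
apply: le_trans tr2; set a := A i j.
have aji : A j i = a^* by rewrite -[in LHS](psd_adj hA) !mxE.
(* The phases of this test vector make both cross terms equal to [- |a|^3], so positivity gives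
   [2 |a| <= A i i + A j j]. *)
have /psdP/(_ (a *: delta_mx i 0 + (- `|a|) *: delta_mx j 0)) := hA.
rewrite !(sformDl, sformDr, sformZl, sformZr) !sform_delta -/a aji.
have nr : `|a|^* = `|a| by rewrite (CrealP _) // normr_real.
have n0 : 0 < `|a| by rewrite normr_gt0.
rewrite rmorphN /= nr.
set L := (X in 0 <= X -> _); have -> : L =
   `|a| ^+ 2 * (A i i + A j j - 2%:R * `|a|).
  rewrite /L; have -> : a^* = `|a| ^+ 2 / a by rewrite normCK mulrAC mulfV // mul1r.
  by field.
rewrite pmulr_rge0 ?exprn_gt0 // subr_ge0 => h.
apply: le_trans h; rewrite mulr_natl mulr2n lerDl; exact: ltW.
Qed.

Lemma psd_tr_mul_le n (A X : 'M[C]_n) : psd A -> psd X ->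
  \tr (A *m X) <= (n * n)%:R * \tr A * \tr X.
Proof.
move=> hA hX; apply: (le_trans (real_ler_norm _)).
  by rewrite ger0_real // psd_tr_mul_ge0.
apply: (le_trans (ler_norm_sum _ _ _)).
have -> : (n * n)%:R * \tr A * \tr X = \sum_(i < n) \sum_(j < n) (\tr A * \tr X).
  under eq_bigr do rewrite sumr_const card_ord.
  by rewrite sumr_const card_ord -mulrnA -mulrA mulr_natl.
apply: ler_sum => i _; rewrite mxE.
apply: (le_trans (ler_norm_sum _ _ _)); apply: ler_sum => j _.
by rewrite normrM ler_pM // psd_entry_le.
Qed.

Lemma psd_sform0 n (A : 'M[C]_n) v : psd A -> sform A v v = 0 -> A *m v = 0.
Proof.
move=> /psd_gramP[B ->]; rewrite sform_gram => /eqP.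
rewrite psumr_eq0 => [/allP h|i _]; last by rewrite exprn_ge0.
rewrite -mulmxA; suff -> : B *m v = 0 by rewrite mulmx0.
apply/matrixP => i j; rewrite (ord1 j) [RHS]mxE.
by have := h i (mem_index_enum _); rewrite expf_eq0 /= normr_eq0 => /eqP.
Qed.

(** The columns of [cokermx B] lie in the kernel of [B], and inclusion of row spaces means that [A]
    vanishes on them. *)
Lemma submx_ker m p n (A : 'M[C]_(m, n)) (B : 'M[C]_(p, n)) :
  (forall v : 'cV[C]_n, B *m v = 0 -> A *m v = 0) -> (A <= B)%MS.
Proof.
move=> hk; rewrite submxE; apply/eqP/matrixP => i j; rewrite [RHS]mxE.
have : A *m col j (cokermx B) = 0.
  by apply: hk; rewrite colE mulmxA mulmx_coker mul0mx.
by rewrite colE mulmxA -colE => /colP/(_ i); rewrite !mxE.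
Qed.

(* Both matrices are factored as Gram matrices; the kernel inclusion lets the
   factor of [A] be written through that of [B]. *)
Lemma psd_ker_dominated n (A B : 'M[C]_n) : psd A -> psd B ->
  (forall v : 'cV[C]_n, B *m v = 0 -> A *m v = 0) ->
  exists2 l : R, 0 <= l & psd (l%:C *: B - A).
Proof.
move=> /psd_gramP[a eA] /psd_gramP[b eB] hk.
have ker_gram (g : 'M[C]_n) (v : 'cV[C]_n) : g ^t* *m g *m v = 0 -> g *m v = 0.
  move=> h; have := sform_gram g v; rewrite /sform -[_ ^t* *m (_ *m _) *m _]mulmxA.
  rewrite h mulmx0 mxE => /esym/eqP.
  rewrite psumr_eq0 => [/allP h'|i _]; last by rewrite exprn_ge0.
  apply/matrixP => i j; rewrite (ord1 j) [RHS]mxE.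
  by have := h' i (mem_index_enum _); rewrite expf_eq0 /= normr_eq0 => /eqP.
have /submxP[c ec] : (a <= b)%MS.
  apply: submx_ker => v bv; apply: ker_gram; rewrite -eA; apply: hk.
  by rewrite eB -mulmxA bv mulmx0.
have hC : psd (c ^t* *m c) by exact: psd_gram.
(* Since [a = c *m b], the form of [A] at [v] is that of the Gram matrix of [c] at [b *m v], while
   the form of [B] at [v] is the squared norm of [b *m v]. The constant is the one given by
   [psd_tr_mul_le]. *)
pose l := complex.Re ((n * n)%:R * \tr (c ^t* *m c)).
have t0 : 0 <= (n * n)%:R * \tr (c ^t* *m c) by rewrite mulr_ge0 ?psd_tr_ge0.
have el : l%:C = (n * n)%:R * \tr (c ^t* *m c) by rewrite RRe_real // ger0_real.
exists l; first by rewrite -lecR el.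
apply/psdP => v; rewrite sformB sformZ subr_ge0 el.
have -> : sform A v v = sform (c ^t* *m c) (b *m v) (b *m v).
  by rewrite /sform eA ec !adjM !mulmxA.
have -> : sform B v v = \tr ((b *m v) *m (b *m v) ^t* ).
  by rewrite mxtrace_mulC trace_mx11 adjM !mulmxA /sform eB !mulmxA.
by rewrite sform_tr psd_tr_mul_le //; exact: psd_outer.
Qed.

End PositiveSemidefinite.

(** * Measure-and-prepare maps and their complete positivity *)

Section MeasurePrepare.
Variable R : realType.
Local Notation C := (R[i]).
Local Notation "x %:C" := (real_complex R x) (format "x %:C").
Variables (n m : nat).

Definition measure_prepare (A B : 'M[C]_n) (P Q : 'M[C]_m) (X : 'M[C]_n) :
  'M[C]_m := \tr (A *m X) *: P + \tr (B *m X) *: Q.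

Lemma measure_prepare_linear A B P Q : linear (measure_prepare A B P Q).
Proof.
move=> c X Y; rewrite /measure_prepare !mulmxDr -!scalemxAr !mxtraceD !mxtraceZ.
by rewrite !scalerDl !scalerDr !scalerA addrACA.
Qed.

HB.instance Definition _ A B P Q :=
  GRing.isLinear.Build C _ _ _ (measure_prepare A B P Q)
    (measure_prepare_linear A B P Q).

Lemma tr_measure_prepare A B P Q X : \tr (measure_prepare A B P Q X) =
  \tr (A *m X) * \tr P + \tr (B *m X) * \tr Q.
Proof. by rewrite mxtraceD !mxtraceZ. Qed.

Lemma measure_prepareZ (c : C) A B P Q X :
  measure_prepare (c *: A) (c *: B) P Q X = c *: measure_prepare A B P Q X.
Proof.
by rewrite /measure_prepare -!scalemxAl !mxtraceZ scalerDr !scalerA.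
Qed.

(** This is a Kraus decomposition: for Gram factors [g] of [A] and [p] of [P], the block form of the
    output at [v] is the sum, over rows [r] of [g] and [s] of [p], of the block form of [X] at a
    vector [u r s]. *)
Lemma block_psd_measure k (A : 'M[C]_n) (P : 'M[C]_m)
    (X : 'I_k -> 'I_k -> 'M[C]_n) : psd A -> psd P -> block_psd X ->
  block_psd (fun a b => \tr (A *m X a b) *: P).
Proof.
move=> /psd_gramP[g ->] /psd_gramP[p ->] hX v.
pose u r s (b : 'I_k) (l : 'I_n) : C := (g r l)^* * \sum_j p s j * v b j.
have -> : \sum_(a < k) \sum_(b < k) \sum_(i < m) \sum_(j < m)
    (v a i)^* * (\tr (g ^t* *m g *m X a b) *: (p ^t* *m p)) i j * v b j =
  \sum_(r < n) \sum_(s < m) \sum_(a < k) \sum_(b < k) \sum_(i < n) \sum_(j < n)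
    (u r s a i)^* * X a b i j * u r s b j.
  transitivity (\sum_(a < k) \sum_(b < k) \sum_(r < n) \sum_(s < m)
     \sum_(i < n) \sum_(j < n) (u r s a i)^* * X a b i j * u r s b j); last first.
    under eq_bigr => a _ do rewrite exchange_big /=.
    rewrite exchange_big /=; apply: eq_bigr => r _.
    under eq_bigr => a _ do rewrite exchange_big /=.
    by rewrite exchange_big.
  apply: eq_bigr => a _; apply: eq_bigr => b _.
  have -> : \tr (g ^t* *m g *m X a b) =
      \sum_(r < n) \sum_(i < n) \sum_(j < n) g r i * X a b i j * (g r j)^*.
    rewrite -mulmxA mxtrace_mulC /mxtrace; apply: eq_bigr => r _.
    rewrite mxE exchange_big; apply: eq_bigr => j _ /=.
    by rewrite !mxE mulr_suml.
  transitivity ((\sum_(r < n) \sum_(i < n) \sum_(j < n) g r i * X a b i j * (g r j)^* ) *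
    (\sum_(s < m) (\sum_i p s i * v a i)^* * (\sum_j p s j * v b j))).
    under eq_bigr => i _ do under eq_bigr => j _ do
      rewrite mxE -mulrA -mulrA mulrCA.
    under eq_bigr => i _ do rewrite -mulr_sumr.
    rewrite -mulr_sumr; congr (_ * _).
    transitivity (\sum_i \sum_j \sum_s (v a i)^* * (p s i)^* * (p s j * v b j)).
      apply: eq_bigr => i _; apply: eq_bigr => j _.
      rewrite mxE mulr_suml mulr_sumr; apply: eq_bigr => s _.
      by rewrite !mxE !mulrA.
    under eq_bigr => i _ do rewrite exchange_big /=.
    rewrite exchange_big /=; apply: eq_bigr => s _.
    rewrite rmorph_sum mulr_suml; apply: eq_bigr => i _.
    by rewrite mulr_sumr; apply: eq_bigr => j _; rewrite rmorphM (mulrC (p s i)^* ).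
  rewrite mulr_suml; apply: eq_bigr => r _.
  rewrite mulr_sumr; apply: eq_bigr => s _.
  rewrite mulr_suml; apply: eq_bigr => i _.
  rewrite mulr_suml; apply: eq_bigr => j _.
  by rewrite /u rmorphM /= conjCK; ring.
by apply: sumr_ge0 => r _; apply: sumr_ge0 => s _; exact: hX.
Qed.

Lemma measure_prepare_cp A B P Q : psd A -> psd B -> psd P -> psd Q ->
  completely_positive (measure_prepare A B P Q).
Proof.
move=> hA hB hP hQ k X hX v; rewrite /measure_prepare /=.
have h1 := block_psd_measure hA hP hX v.
have h2 := block_psd_measure hB hQ hX v.
apply: le_trans (addr_ge0 h1 h2) _; rewrite le_eqVlt; apply/orP; left; apply/eqP.
rewrite -big_split; apply: eq_bigr => a _ /=.
rewrite -big_split; apply: eq_bigr => b _ /=.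
rewrite -big_split; apply: eq_bigr => i _ /=.
rewrite -big_split; apply: eq_bigr => j _ /=.
by rewrite -mulrDl -mulrDr [in RHS]mxE.
Qed.

(* Rescaling [A] and [B] makes the map trace-non-increasing without affecting
   the normalized output. *)
Lemma measure_prepare_RNG (F : set 'M[C]_n) (F' : set 'M[C]_m) A B P Q rho :
  (forall s, F s -> density s) -> (forall s, F' s -> density s) ->
  psd A -> psd B -> psd P -> psd Q ->
  (forall s, F s -> cone F' (measure_prepare A B P Q s)) ->
  0 < \tr (measure_prepare A B P Q rho) ->
  exists E : {linear 'M[C]_n -> 'M[C]_m},
    [/\ RNG F F' E, 0 < \tr (E rho) &
      (\tr (E rho))^-1 *: E rho = (\tr (measure_prepare A B P Q rho))^-1 *:
        measure_prepare A B P Q rho].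
Proof.
move=> dF dF' hA hB hP hQ hF h0.
(* By [psd_tr_mul_le], [K] bounds the trace of the output relative to that of the input; the summand
   1 keeps it invertible. *)
pose K : C := 1 + ((n * n)%:R * \tr A * \tr P + (n * n)%:R * \tr B * \tr Q).
have K0 : 0 < K.
  by rewrite ltr_pwDl // addr_ge0 // !mulr_ge0 // psd_tr_ge0.
have cr : K^-1 \is Num.real by rewrite ger0_real // invr_ge0 ltW.
have c0 : 0 < K^-1 by rewrite invr_gt0.
have tni : trace_nonincreasing (measure_prepare (K^-1 *: A) (K^-1 *: B) P Q).
  move=> X hX; rewrite measure_prepareZ mxtraceZ ler_pdivrMl // tr_measure_prepare.
  have X0 := psd_tr_ge0 hX.
  apply: (@le_trans _ _ (((n * n)%:R * \tr A * \tr P + (n * n)%:R * \tr B * \tr Q) * \tr X)).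
    rewrite mulrDl mulrAC (mulrAC _ (\tr Q)).
    by apply: lerD; apply: ler_wpM2r; rewrite ?psd_tr_ge0 // psd_tr_mul_le.
  by rewrite ler_wpM2r // /K lerDr.
exists (measure_prepare (K^-1 *: A) (K^-1 *: B) P Q); split.
- split=> //.
    by apply: measure_prepare_cp => //; apply: psdZ => //; exact: ltW.
  move=> s Fs; have [mu [s' Fs' [mu0 es]]] := hF s Fs.
  exists s', (mu * complex.Re K^-1).
  have ec : (mu * complex.Re K^-1)%:C = K^-1 * mu%:C.
    by rewrite rmorphM /= RRe_real // mulrC.
  have eE : measure_prepare (K^-1 *: A) (K^-1 *: B) P Q s =
      (mu * complex.Re K^-1)%:C *: s'.
    by rewrite measure_prepareZ es scalerA ec.
  split=> //; apply/andP; split.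
    by rewrite -lecR ec mulr_ge0 ?ler0c // ltW.
  (* Both free states have trace one, so [p <= 1] is trace non-increase at [s]. *)
  have [hs ts] := dF s Fs; have [_ ts'] := dF' s' Fs'.
  by have := tni s hs; rewrite eE mxtraceZ ts' ts mulr1 lecR.
- by rewrite /= measure_prepareZ mxtraceZ mulr_gt0.
- rewrite /= measure_prepareZ mxtraceZ scalerA invfM mulrAC -scalerA.
  by rewrite mulVf ?scale1r // gt_eqF.
Qed.

End MeasurePrepare.

(** * Cluster points of bounded families and approximate separation from a cone *)

Section Separation.
Variable R : realType.
Local Notation C := (R[i]).
Local Notation "x %:C" := (real_complex R x) (format "x %:C").

(** The nested nonempty sets [D e] generate a proper filter that contains a compact cube, hence has
    a cluster point there. Functions on [I] are encoded as row vectors for this purpose. *)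
Lemma bounded_cluster (I : finType) (D : R -> set (I -> R)) (M : R) :
  (forall e, 0 < e -> D e !=set0) ->
  (forall e e', 0 < e -> e <= e' -> D e `<=` D e') ->
  (forall e y i, 0 < e -> D e y -> `|y i| <= M) ->
  exists x : I -> R, forall e, 0 < e ->
    exists2 y, D e y & forall i, `|x i - y i| < e.
Proof.
move=> Dn Dm Db.
pose enc (y : I -> R) : 'rV[R]_#|I| := \row_k y (enum_val k).
pose G : set_system 'rV[R]_#|I| :=
  [set A | exists2 e, 0 < e & forall y, D e y -> A (enc y)].
have FG : ProperFilter G.
  split; first by move=> [e /Dn[y Dy] /(_ y Dy)].
  split; first by exists 1.
  - move=> P Q [e e0 hP] [e' e'0 hQ]; exists (Num.min e e').
      by rewrite lt_min e0.
    have m0 : 0 < Num.min e e' by rewrite lt_min e0.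
    move=> y Dy; split; [apply: hP|apply: hQ]; apply: Dm Dy => //.
      by rewrite ge_min lexx.
    by rewrite ge_min lexx orbT.
  - by move=> P Q PQ [e e0 hP]; exists e => // y /hP/PQ.
have cK := @rV_compact _ #|I| (fun=> `[-M, M]%classic) (fun=> @segment_compact _ _ _).
have GK : G [set v : 'rV[R]_#|I| | forall i, `[-M, M]%classic (v 0 i)].
  exists 1 => // y Dy i /=; rewrite in_itv /= mxE -ler_norml.
  exact: (Db 1).
have [x [_ clx]] := cK G FG GK.
exists (fun i => x 0 (enum_rank i)) => e e0.
have Ge : G [set enc y | y in D e] by exists e => // y Dy; exists y.
have [_ [[y Dy <-] hb]] := clx _ _ Ge (nbhsx_ballx x e e0).
exists y => // i; have := hb.2 0 (enum_rank i).
by rewrite /ball /= mxE enum_rankK.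
Qed.

(* The nearest point of [K] need not exist; a point within [e ^+ 2] of the
   infimal squared distance already gives an almost separating functional. *)
Lemma approx_separation (V : lmodType C) (dot : V -> V -> R) (K : set V)
    (x : V) (d : R) :
  (forall u v w, dot (u + v) w = dot u w + dot v w) ->
  (forall u v, dot u v = dot v u) ->
  (forall t u v, dot (t%:C *: u) v = t * dot u v) ->
  (forall u, 0 <= dot u u) ->
  K 0 -> (forall u v, K u -> K v -> K (u + v)) ->
  (forall t u, 0 <= t -> K u -> K (t%:C *: u)) ->
  (forall y, K y -> d <= dot (x - y) (x - y)) ->
  forall e, 0 < e <= 1 -> exists y,
    [/\ K y, forall z, K z -> dot (x - y) z <= e * (1 + dot z z) &
        d - e * (3 + 4 * dot x x) <= dot (x - y) x].
Proof.
move=> dD dC dZ d0 K0 KD KZ hd e /andP[e0 e1].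
pose S := [set dot (x - y) (x - y) | y in K].
have dDr u v w : dot u (v + w) = dot u v + dot u w by rewrite dC dD !(dC u).
have dZr t u v : dot u (t%:C *: v) = t * dot u v by rewrite dC dZ dC.
have S0 : has_inf S.
  split; first by exists (dot (x - 0) (x - 0)), 0.
  by exists 0 => _ [y _ <-].
have e2 : 0 < e ^+ 2 by rewrite exprn_gt0.
have [_ [y Ky <-] hy] := inf_adherent e2 S0.
have lbS z : K z -> dot (x - y) (x - y) - e ^+ 2 < dot (x - z) (x - z).
  move=> Kz; rewrite ltrBlDr; apply: lt_le_trans hy _.
  by rewrite lerD2r; apply: ge_inf; [case: S0|exists z].
exists y; set f := x - y.
have fE g t z : dot (g + t%:C *: z) (g + t%:C *: z) =
    dot g g + 2 * t * dot g z + t ^+ 2 * dot z z.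
  by rewrite dD !dDr !dZ !dZr (dC z g); ring.
split=> //.
  (* First variation: moving from [y] to [y + e z] inside the cone lowers the squared distance by
     less than [e ^+ 2]. *)
  move=> z Kz; have := lbS _ (KD _ _ Ky (KZ e z (ltW e0) Kz)).
  have -> : x - (y + e%:C *: z) = f + (- e)%:C *: z.
    by rewrite /f opprD addrA rmorphN scaleNr.
  rewrite fE -/f => h.
  have {}h : e * (2 * dot f z - e * (1 + dot z z)) < 0 by nra.
  rewrite pmulr_rlt0 // in h; have := d0 z; have := ltW e0; nra.
(* Shrinking [y] to [(1 - e) y] bounds [dot f y] from below; it would vanish at an exact nearest
   point. *)
have hyy : - e * (1 + dot y y) <= 2 * dot f y.
  have h1e : 0 <= 1 - e by rewrite subr_ge0.
  have := lbS _ (KZ (1 - e) y h1e Ky).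
  have -> : x - (1 - e)%:C *: y = f + e%:C *: y.
    by rewrite /f rmorphB rmorph1 scalerBl scale1r opprB addrCA addrC.
  rewrite fE -/f => h.
  have {}h : 0 < e * (2 * dot f y + e * (1 + dot y y)) by nra.
  rewrite pmulr_rgt0 // in h; lra.
have ff : dot f f <= dot x x + 1.
  have := lbS _ K0; rewrite subr0 -/f => h; have : e ^+ 2 <= 1 by nra.
  lra.
have xE : dot x x = dot f f + 2 * dot f y + dot y y.
  by have := fE f 1 y; rewrite rmorph1 scale1r /f subrK => ->; ring.
(* As [y = x - f], nonnegativity of the squared norm of [f + x] gives
   [dot y y <= 2 dot f f + 2 dot x x]. This makes the error terms independent of [y]. *)
have yy : dot y y <= 4 * dot x x + 2.
  have := d0 (f + 1%:C *: x); rewrite fE.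
  have yE : dot y y = dot f f - 2 * dot f x + dot x x.
    have := fE f (-1) x; have -> : f + (-1)%:C *: x = (-1)%:C *: y.
      by rewrite rmorphN rmorph1 !scaleN1r /f addrAC subrr add0r.
    by rewrite dZ dZr; lra.
  lra.
have fx : dot f x = dot f f + dot f y by rewrite -dDr /f subrK.
have := hd _ Ky; rewrite -/f fx => hdf.
have := d0 x; have := d0 y; nra.
Qed.

End Separation.

(** * Closedness of positivity and of the free sandwich condition *)

Section Closeness.
Variable R : realType.
Local Notation C := (R[i]).
Local Notation "x %:C" := (real_complex R x) (format "x %:C").

Lemma normc_le_ReIm (z : C) : `|z| <= (`|complex.Re z| + `|complex.Im z|)%:C.
Proof.
rewrite {1}(complexE z); apply: (le_trans (ler_normD _ _)).
rewrite rmorphD normrM; apply: lerD; first by rewrite normc_def /= expr0n addr0 sqrtr_sqr.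
rewrite [X in X * _](_ : _ = 1) ?mul1r; last first.
  by rewrite normc_def /= expr0n add0r expr1n sqrtr1.
by rewrite normc_def /= expr0n addr0 sqrtr_sqr.
Qed.

Lemma ReIm_le_normc (z : C) (e : R) : `|z| <= e%:C ->
  `|complex.Re z| <= e /\ `|complex.Im z| <= e.
Proof.
rewrite normc_def lecR => h.
by split; apply: le_trans h; rewrite -sqrtr_sqr ler_sqrt ?addr_ge0 ?sqr_ge0 //;
  rewrite (lerDl, lerDr) sqr_ge0.
Qed.

Lemma ge0_closed (q : C) :
  (forall e : R, 0 < e -> exists2 y : C, 0 <= y & `|q - y| <= e%:C) -> 0 <= q.
Proof.
move=> h; rewrite lecE /=; apply/andP; split.
  rewrite -normr_le0; apply/ler_addgt0Pr => e e0; rewrite add0r.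
  have [y y0 /ReIm_le_normc[_]] := h e e0.
  by rewrite raddfB /= (ger0_Im y0) subr0.
rewrite -oppr_le0; apply/ler_addgt0Pr => e e0; rewrite add0r.
have [y y0 /ReIm_le_normc[+ _]] := h e e0.
rewrite raddfB /= ler_norml => /andP[h1 _].
have : 0 <= complex.Re y by move: y0; rewrite lecE => /andP[].
lra.
Qed.

Lemma psd_closed n : closed_mx_set (@psd R n).
Proof.
move=> X hX; apply/psdP => v; apply: ge0_closed => e e0.
(* [N] is a Lipschitz constant of the form at [v] for the entrywise distance; it may be zero, hence
   the divisor [1 + N] below. *)
pose N : C := \sum_(i < n) \sum_(j < n) `|v i 0| * `|v j 0|.
have N0 : 0 <= N.
  by apply: sumr_ge0 => i _; apply: sumr_ge0 => j _; rewrite mulr_ge0.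
have NR : (complex.Re N)%:C = N by rewrite RRe_real // ger0_real.
have N0' : 0 <= complex.Re N by rewrite -ler0c NR.
have e'0 : 0 < e / (1 + complex.Re N) by rewrite divr_gt0 // ltr_pwDl.
have [Y hY XY] := hX _ e'0.
exists (sform Y v v); first by move/psdP: hY.
rewrite -sformB sformE; apply: (@le_trans _ _ ((e / (1 + complex.Re N))%:C * N)).
  apply: (le_trans (ler_norm_sum _ _ _)); rewrite mulr_sumr.
  apply: ler_sum => i _; apply: (le_trans (ler_norm_sum _ _ _)).
  rewrite mulr_sumr; apply: ler_sum => j _; rewrite !normrM norm_conjC !mxE.
  rewrite mulrAC mulrC ler_wpM2r ?mulr_ge0 //; exact/ltW/XY.
rewrite -NR -rmorphM lecR mulrAC ler_pdivrMr ?ltr_pwDl // ler_pM2l //.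
by rewrite lerDr.
Qed.

(* A convergent subfamily of the pairs [(t, s)] is extracted from their real
   coordinates. *)
Lemma sandwich_closed n (F : set 'M[C]_n) (rho tau : 'M[C]_n) (M : R) :
  (forall s, F s -> density s) -> closed_mx_set F ->
  (forall e : R, 0 < e -> exists t s S T,
    [/\ F s, 0 <= t <= M, psd S /\ psd T, mx_close (t%:C *: s - rho) S e &
        mx_close (tau - t%:C *: s) T e]) ->
  exists t s, [/\ F s, psd (t%:C *: s - rho) & psd (tau - t%:C *: s)].
Proof.
move=> dF cF H.
pose enc (t : R) (s : 'M[C]_n) (k : option (bool * ('I_n * 'I_n))) : R :=
  match k with None => t | Some (b, (i, j)) =>
    if b then complex.Re (s i j) else complex.Im (s i j) end.
pose D (e : R) := [set y | exists t s S T,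
    [/\ F s, 0 <= t <= M, psd S /\ psd T, mx_close (t%:C *: s - rho) S e &
        mx_close (tau - t%:C *: s) T e] /\ y = enc t s].
have entry_le s i j : F s -> `|s i j| <= 1%:C.
  by move=> /dF[hs ts]; rewrite rmorph1 -ts psd_entry_le.
(* Entries of a density matrix have modulus at most 1, and [t] is at most [M]. *)
have [] := @bounded_cluster _ _ D (Num.max 1 M).
- by move=> e /H[t [s [S [T h]]]]; exists (enc t s), t, s, S, T.
- move=> e e' _ ee' y [t [s [S [T [[Fs tM ST h1 h2] ->]]]]].
  exists t, s, S, T; split=> //; split=> // i j.
    by apply: lt_le_trans (h1 i j) _; rewrite lecR.
  by apply: lt_le_trans (h2 i j) _; rewrite lecR.
- move=> e y k _ [t [s [S [T [[Fs /andP[t0 tM] ST h1 h2] ->]]]]].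
  rewrite le_max; case: k => [[b [i j]]|] /=; last first.
    by rewrite ger0_norm // tM orbT.
  have [hr hi] := ReIm_le_normc (entry_le s i j Fs).
  by case: b; [rewrite hr|rewrite hi].
move=> x hx.
pose t0 := x None.
pose s0 : 'M[C]_n := \matrix_(i, j)
  Complex (x (Some (true, (i, j)))) (x (Some (false, (i, j)))).
have {}hx e : 0 < e -> exists t s S T,
    [/\ F s, psd S /\ psd T, `|t0 - t| < e, mx_close s0 s (2 * e) &
      mx_close (t%:C *: s - rho) S e /\ mx_close (tau - t%:C *: s) T e].
  move=> e0; have [y [t [s [S [T [[Fs tM ST h1 h2] ->]]]]] h] := hx e e0.
  exists t, s, S, T; split=> //; first exact: (h None).
  move=> i j; apply: le_lt_trans (normc_le_ReIm _) _; rewrite ltcR !raddfB /= !mxE /=.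
  have := h (Some (true, (i, j))); have := h (Some (false, (i, j))) => /=; lra.
have prod_close e t s : F s -> `|t0 - t| < e -> mx_close s0 s (2 * e) ->
    forall i j, `|t0%:C * s0 i j - t%:C * s i j| <= ((1 + 2 * `|t0|) * e)%:C.
  move=> Fs ht hs i j.
  have -> : t0%:C * s0 i j - t%:C * s i j =
      t0%:C * (s0 i j - s i j) + (t0 - t)%:C * s i j by rewrite rmorphB; ring.
  apply: (le_trans (ler_normD _ _)); rewrite !normrM.
  have nr (r : R) : `|r%:C| = `|r|%:C :> C.
    by rewrite normc_def /= expr0n addr0 sqrtr_sqr.
  apply: (@le_trans _ _ (`|t0|%:C * (2 * e)%:C + e%:C * 1%:C)).
    apply: lerD; apply: ler_pM => //; first by rewrite nr.
    + exact/ltW/hs.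
    + by rewrite nr lecR ltW.
    + exact: entry_le.
  rewrite -!rmorphM -rmorphD lecR; lra.
exists t0, s0.
(* The divisor is the constant [1 + 2 |t0|] of [prod_close] plus 1, which pays for the distance to
   the semidefinite matrix. *)
have dpos e : 0 < e -> 0 < e / (2 + 2 * `|t0|).
  by move=> e0; rewrite divr_gt0 // ltr_pwDl // mulr_ge0.
have de (e : R) : (1 + 2 * `|t0|) * (e / (2 + 2 * `|t0|)) + e / (2 + 2 * `|t0|) = e.
  have : 2 + 2 * `|t0| != 0 by rewrite gt_eqF // ltr_pwDl // mulr_ge0.
  by move=> ?; field.
split.
- apply: cF => e e0; have h20 : 0 < e / 2 by rewrite divr_gt0.
  have [t [s [S [T [Fs _ _ h _]]]]] := hx _ h20.
  by exists s => //; move: h; rewrite mulrC divfK.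
- apply: psd_closed => e e0.
  have [t [s [S [T [Fs [hS _] ht h [h1 _]]]]]] := hx _ (dpos e e0).
  exists S => // i j; rewrite -(de e) rmorphD.
  have -> : (t0%:C *: s0 - rho) i j - S i j = (t0%:C * s0 i j - t%:C * s i j) +
      ((t%:C *: s - rho) i j - S i j) by rewrite !mxE; ring.
  apply: le_lt_trans (ler_normD _ _) _; apply: ler_ltD; last exact: h1.
  exact: prod_close.
- apply: psd_closed => e e0.
  have [t [s [S [T [Fs [_ hT] ht h [_ h1]]]]]] := hx _ (dpos e e0).
  exists T => // i j; rewrite -(de e) rmorphD.
  have -> : (tau - t0%:C *: s0) i j - T i j = - (t0%:C * s0 i j - t%:C * s i j) +
      ((tau - t%:C *: s) i j - T i j) by rewrite !mxE; ring.
  apply: le_lt_trans (ler_normD _ _) _; rewrite normrN.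
  by apply: ler_ltD; [exact: prod_close|exact: h1].
Qed.

End Closeness.

(** * Bounds on the robustness measures, free cones, and the Hilbert-Schmidt product *)

Section Duality.
Variable R : realType.
Local Notation C := (R[i]).
Local Notation "x %:C" := (real_complex R x) (format "x %:C").

(** Take traces in [X <= l Y]. The bound also keeps zero times infinity out of the products that
    define [Omega_F]. *)
Lemma Rmax_ge1 n (X Y : 'M[C]_n) : density X -> density Y -> (1%:E <= Rmax X Y)%E.
Proof.
move=> [_ tX] [_ tY]; apply: le_ereal_inf_tmp => _ [l /= hl <-].
have := psd_tr_ge0 hl; rewrite raddfB /= mxtraceZ tX tY mulr1 subr_ge0.
by rewrite -(rmorph1 (real_complex R)) lecR lee_fin.
Qed.

Lemma Rmax_le n (X Y : 'M[C]_n) (l : R) : psd (l%:C *: Y - X) ->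
  (Rmax X Y <= l%:E)%E.
Proof. by move=> h; apply: ereal_inf_lbound; exists l. Qed.

(** The sandwich [rho <= t s <= w rho] makes [t] feasible for [Rmax rho s] and [w / t] feasible for
    [Rmax s rho]. *)
Lemma Omega_F_le n (F : set 'M[C]_n) (rho s : 'M[C]_n) (t w : R) :
  density rho -> density s -> F s ->
  psd (t%:C *: s - rho) -> psd (w%:C *: rho - t%:C *: s) ->
  (Omega_F F rho <= w%:E)%E.
Proof.
move=> dr ds Fs h1 h2.
have t1 : 1 <= t.
  have := le_trans (Rmax_ge1 dr ds) (Rmax_le h1); by rewrite lee_fin.
have t0 : 0 < t by apply: lt_le_trans t1.
have h3 : psd ((t^-1 * w)%:C *: rho - s).
  rewrite (_ : _ - _ = t^-1%:C *: (w%:C *: rho - t%:C *: s)).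
    by apply: psdZ => //; rewrite ler0c invr_ge0 ltW.
  rewrite scalerBr !scalerA -!(rmorphM (real_complex R)) mulVf ?gt_eqF //.
  by rewrite (rmorph1 (real_complex R)) scale1r.
apply: (@le_trans _ _ (Rmax rho s * Rmax s rho)%E).
  by apply: ereal_inf_lbound; exists s.
have -> : w%:E = (t%:E * (t^-1 * w)%:E)%E.
  by rewrite -EFinM mulrA mulfV ?gt_eqF // mul1r.
have p1 : (0 <= Rmax rho s)%E by apply: le_trans (Rmax_ge1 dr ds); rewrite lee_fin.
have p2 : (0 <= Rmax s rho)%E by apply: le_trans (Rmax_ge1 ds dr); rewrite lee_fin.
by apply: lee_pmul => //; apply: Rmax_le.
Qed.

Lemma coneD n (F : set 'M[C]_n) X Y : convex_mx_set F ->
  cone F X -> cone F Y -> cone F (X + Y).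
Proof.
move=> cF [a [s Fs [a0 ->]]] [b [s' Fs' [b0 ->]]].
(* The weights [a / (a + b)] of the convex combination need a nonzero sum; otherwise both terms
   vanish. *)
have [/eqP ab0|ab0] := boolP (a + b == 0).
  have ea : a = 0 by lra.
  have eb : b = 0 by lra.
  by exists 0, s => //; rewrite ea eb !scale0r addr0.
have abp : 0 < a + b by rewrite lt_def ab0 addr_ge0.
exists (a + b), ((a / (a + b))%:C *: s + (1 - a / (a + b))%:C *: s').
  apply: cF => //; rewrite divr_ge0 ?(ltW abp) //= ler_pdivrMr // mul1r lerDl //.
split; first exact: ltW.
have e1 : (a + b) * (a / (a + b)) = a by field.
have e2 : (a + b) * (1 - a / (a + b)) = b by field.
by rewrite scalerDr !scalerA -!(rmorphM (real_complex R)) e1 e2.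
Qed.

Lemma coneZ n (F : set 'M[C]_n) (t : R) X : 0 <= t ->
  cone F X -> cone F (t%:C *: X).
Proof.
move=> t0 [a [s Fs [a0 ->]]]; exists (t * a), s => //.
by rewrite mulr_ge0 // scalerA rmorphM.
Qed.

Lemma cone_mem n (F : set 'M[C]_n) s : F s -> cone F s.
Proof. by move=> Fs; exists 1, s => //; rewrite (rmorph1 (real_complex R)) scale1r. Qed.

(** The real part of the Hilbert-Schmidt product turns complex matrices into a real inner product
    space, the setting of [approx_separation]. *)
Definition hsdot n (X Y : 'M[C]_n) : R := complex.Re (\tr (X *m Y ^t* )).

Lemma hsdotDl n (X Y Z : 'M[C]_n) : hsdot (X + Y) Z = hsdot X Z + hsdot Y Z.
Proof. by rewrite /hsdot mulmxDl mxtraceD raddfD. Qed.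

Lemma hsdotZl n (t : R) (X Y : 'M[C]_n) : hsdot (t%:C *: X) Y = t * hsdot X Y.
Proof.
rewrite /hsdot -scalemxAl mxtraceZ; case: (\tr _) => a b /=.
by rewrite mul0r subr0.
Qed.

Lemma hsdotC n (X Y : 'M[C]_n) : hsdot X Y = hsdot Y X.
Proof.
rewrite /hsdot -[X in X *m Y ^t* ]trmxCK -adjM /mxtrace.
have -> : \sum_i (Y *m X ^t* ) ^t* i i = (\sum_i (Y *m X ^t* ) i i)^*.
  by rewrite rmorph_sum; apply: eq_bigr => i _; rewrite !mxE.
by case: (\sum_i _).
Qed.

Lemma hsdotxx n (X : 'M[C]_n) :
  (hsdot X X)%:C = \sum_(i < n) \sum_(j < n) `|X i j| ^+ 2.
Proof.
have e : \tr (X *m X ^t* ) = \sum_(i < n) \sum_(j < n) `|X i j| ^+ 2.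
  by apply: eq_bigr => i _; rewrite mxE; apply: eq_bigr => j _; rewrite !mxE normCK.
rewrite /hsdot e RRe_real // ger0_real // sumr_ge0 // => i _.
by apply: sumr_ge0 => j _; rewrite exprn_ge0.
Qed.

Lemma hsdotxx_ge0 n (X : 'M[C]_n) : 0 <= hsdot X X.
Proof.
rewrite -ler0c hsdotxx sumr_ge0 // => i _.
by apply: sumr_ge0 => j _; rewrite exprn_ge0.
Qed.

Lemma hsdotxx_small n (X Y : 'M[C]_n) (e : R) : 0 < e ->
  hsdot (X - Y) (X - Y) < e ^+ 2 -> mx_close X Y e.
Proof.
move=> e0 h i j; rewrite -(@ltr_pXn2r _ 2) ?nnegrE ?normr_ge0 ?ler0c ?(ltW e0) //.
apply: (@le_lt_trans _ _ (hsdot (X - Y) (X - Y))%:C); last first.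
  by rewrite -rmorphXn ltcR.
rewrite hsdotxx (bigD1 i) //= (bigD1 j) //= !mxE -addrA lerDl.
apply: addr_ge0; apply: sumr_ge0 => k _; first by rewrite exprn_ge0.
by apply: sumr_ge0 => l _; rewrite exprn_ge0.
Qed.

Lemma hsdot_density n (s : 'M[C]_n) : density s -> hsdot s s <= (n * n)%:R.
Proof.
move=> [hs ts]; rewrite -lecR hsdotxx rmorph_nat.
have -> : (n * n)%:R = \sum_(i < n) \sum_(j < n) (1 : C).
  by rewrite !sumr_const !card_ord -mulrnA.
apply: ler_sum => i _; apply: ler_sum => j _.
by rewrite expr_le1 // -ts psd_entry_le.
Qed.

Lemma hsdot_psd n (X S : 'M[C]_n) : psd S -> hsdot X S = complex.Re (\tr (X *m S)).
Proof. by move=> /psd_adj h; rewrite /hsdot h. Qed.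

Lemma hsdot_outer n (X : 'M[C]_n) v :
  hsdot X (v *m v ^t* ) = complex.Re (sform X v v).
Proof. by rewrite (hsdot_psd _ (psd_outer v)) sform_tr. Qed.

Lemma sform1 n (v : 'cV[C]_n) : 0 <= sform 1%:M v v ?= iff (v == 0).
Proof.
have e : sform 1%:M v v = \sum_i `|v i 0| ^+ 2.
  rewrite /sform mulmx1 mxE; apply: eq_bigr => i _.
  by rewrite !mxE normCK mulrC.
have p : 0 <= sform 1%:M v v by have /psdP := @psd1 R n.
split=> //; rewrite eq_sym; apply/eqP/eqP => [h0|->]; last first.
  by rewrite /sform mulmx0 mxE.
move/eqP: h0; rewrite e psumr_eq0 => [/allP h|i _]; last by rewrite exprn_ge0.
apply/matrixP => i j; rewrite (ord1 j) [RHS]mxE.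
by have := h i (mem_index_enum _); rewrite expf_eq0 /= normr_eq0 => /eqP.
Qed.

(** Testing on the rank-one projector onto [v], which has [hsdot S S = 1], bounds the form of [H]
    below by [- 2 c] times the squared norm of [v]; hermiticity makes this form real. *)
Lemma psd_shift n (H : 'M[C]_n) (c : R) : H ^t* = H ->
  (forall S, psd S -> - c * (1 + hsdot S S) <= hsdot H S) ->
  psd (H + (2 * c)%:C *: 1%:M).
Proof.
move=> hH h; apply/psdP => v.
have [->|v0] := eqVneq v 0; first by rewrite /sform mulmx0 mxE.
pose N := complex.Re (sform 1%:M v v).
have [p1 p2] := sform1 v.
have NR : N%:C = sform 1%:M v v by rewrite RRe_real // ger0_real.
have N0 : 0 < N.
  by rewrite -ltcR NR lt_def p1 andbT eq_sym p2.
have := h (N^-1%:C *: (v *m v ^t* )) (psdZ _ (psd_outer _)).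
rewrite !(hsdotC _ (_ *: _)) !hsdotZl !(hsdotC (_ *m _)) hsdotZl !hsdot_outer.
have -> : sform (v *m v ^t* ) v v = (N ^+ 2)%:C.
  rewrite rmorphXn /= NR expr2 /sform !mulmxA mulmx1 -mulmxA.
  by rewrite [in LHS]mxE big_ord1.
rewrite ler0c invr_ge0 (ltW N0) => /(_ isT).
have hr : sform H v v \is Num.real.
  by apply/CrealP; rewrite -sform_adj hH.
rewrite sformD sformZ -NR -(RRe_real hr) -rmorphM -rmorphD ler0c /=.
set q := complex.Re _.
have -> : N^-1 * (N^-1 * N ^+ 2) = 1 by field; rewrite gt_eqF.
rewrite ler_pdivlMl // => hq; lra.
Qed.

End Duality.

(** * Dual witnesses for a lower bound on [Omega_F] *)

Section Witness.
Variable R : realType.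
Local Notation C := (R[i]).
Local Notation "x %:C" := (real_complex R x) (format "x %:C").

Lemma hsdotNN n (X : 'M[C]_n) : hsdot (- X) (- X) = hsdot X X.
Proof.
have e Y : - Y = (-1)%:C *: Y :> 'M[C]_n by rewrite rmorphN rmorph1 scaleN1r.
by rewrite {1}e hsdotZl hsdotC e hsdotZl; ring.
Qed.

Lemma hsdotBl n (X Y Z : 'M[C]_n) : hsdot (X - Y) Z = hsdot X Z - hsdot Y Z.
Proof. by rewrite /hsdot mulmxBl !raddfB. Qed.

Lemma tr_close n (X Y : 'M[C]_n) e :
  mx_close X Y e -> `|\tr X - \tr Y| <= (n%:R * e)%:C.
Proof.
move=> h; rewrite -raddfB /= /mxtrace; apply: (le_trans (ler_norm_sum _ _ _)).
have -> : (n%:R * e)%:C = \sum_(i < n) e%:C.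
  by rewrite sumr_const card_ord mulr_natl rmorphMn.
by apply: ler_sum => i _; rewrite !mxE; exact/ltW/h.
Qed.

Lemma sandwich_dist_gt0 n (F : set 'M[C]_n) (rho : 'M[C]_n) (w : R) :
  free_set F -> density rho -> (w%:E < Omega_F F rho)%E ->
  exists2 d : R, 0 < d & forall s S T, cone F s -> psd S -> psd T ->
    d <= hsdot (rho - (s - S)) (rho - (s - S)) +
         hsdot (- (w%:C *: rho) - (- s - T)) (- (w%:C *: rho) - (- s - T)).
Proof.
move=> [_ dF cF _] dr hw; apply: contrapT => nd.
have near e : 0 < e -> exists s S T, [/\ cone F s, psd S, psd T &
    hsdot (rho - (s - S)) (rho - (s - S)) +
    hsdot (- (w%:C *: rho) - (- s - T)) (- (w%:C *: rho) - (- s - T)) < e ^+ 2].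
  move=> e0; apply: contrapT => H; apply: nd; exists (e ^+ 2).
    by rewrite exprn_gt0.
  move=> s S T cs hS hT; rewrite leNgt; apply/negP => lt.
  by apply: H; exists s, S, T.
have [] := @sandwich_closed R n F rho (w%:C *: rho) (w + n%:R) dF cF.
  (* Capping the error at 1 gives the bound on [t]: the trace of [w rho - t s] is [w - t], and it is
     within [n] of the nonnegative trace of [T]. *)
  move=> e e0; have m0 : 0 < Num.min e 1 by rewrite lt_min e0 ltr01.
  have [_ [S [T [[t [s Fs [t0 ->]]] hS hT lt]]]] := near _ m0.
  have close1 : mx_close (t%:C *: s - rho) S (Num.min e 1).
    apply: hsdotxx_small => //.
    have -> : t%:C *: s - rho - S = - (rho - (t%:C *: s - S)).
      by rewrite opprB addrAC.
    rewrite hsdotNN; apply: le_lt_trans lt; rewrite lerDl; exact: hsdotxx_ge0.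
  have close2 : mx_close (w%:C *: rho - t%:C *: s) T (Num.min e 1).
    apply: hsdotxx_small => //.
    have -> : w%:C *: rho - t%:C *: s - T =
        - (- (w%:C *: rho) - (- (t%:C *: s) - T)).
      by rewrite opprB opprK -addrA addrC.
    rewrite hsdotNN; apply: le_lt_trans lt; rewrite lerDr; exact: hsdotxx_ge0.
  have min_le X Y : mx_close X Y (Num.min e 1) -> mx_close X Y e.
    move=> h i j; apply: lt_le_trans (h i j) _.
    by rewrite lecR ge_min lexx.
  exists t, s, S, T; split=> //; [|exact: min_le..].
  rewrite t0 /=; have /ReIm_le_normc[+ _] := tr_close close2.
  have [_ ts] := dF s Fs; have [_ tr] := dr.
  have tT : 0 <= complex.Re (\tr T).
    by have := psd_tr_ge0 hT; rewrite lecE => /andP[].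
  rewrite [\tr (_ - _)]raddfB /= !mxtraceZ ts tr !mulr1 !raddfB /=.
  rewrite ler_norml => /andP[h _].
  have hn : n%:R * Num.min e 1 <= n%:R :> R.
    by rewrite ler_piMr // ge_min lexx orbT.
  move: h tT hn; clear; lra.
move=> t [s [Fs h1 h2]].
have := Omega_F_le dr (dF s Fs) Fs h1 h2.
by rewrite leNgt hw.
Qed.

Lemma Re_psd_tr n (A X : 'M[C]_n) : psd A -> psd X ->
  \tr (A *m X) = (complex.Re (\tr (A *m X)))%:C.
Proof. by move=> hA hX; rewrite RRe_real // ger0_real // psd_tr_mul_ge0. Qed.

(* Dual certificates for [w < Omega_F F rho]: separate the pair
   [(rho, - w rho)] from the cone of all [(s - S, - s - T)], then repair the
   approximate separating functional with small multiples of the identity. *)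
Lemma Omega_F_dual n (F : set 'M[C]_n) (rho : 'M[C]_n) (w : R) :
  free_set F -> density rho -> 0 <= w -> (w%:E < Omega_F F rho)%E ->
  exists A B, [/\ psd A, psd B, forall s, F s -> \tr (A *m s) <= \tr (B *m s) &
    w%:C * \tr (B *m rho) < \tr (A *m rho)].
Proof.
move=> fF dr w0 hw; have [d d0 hd] := sandwich_dist_gt0 fF dr hw.
have [[sF FsF] dF cF coF] := fF.
have [hr tr] := dr.
pose V := ('M[C]_n * 'M[C]_n)%type.
pose dot (u v : V) := hsdot u.1 v.1 + hsdot u.2 v.2.
pose K : set V := [set z | exists s S T,
  [/\ cone F s, psd S, psd T & z = (s - S, - s - T)]].
pose x : V := (rho, - (w%:C *: rho)).
have cone0 : cone F 0 by exists 0, sF => //; rewrite scale0r.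
have K1 S : psd S -> K (- S, 0).
  by move=> hS; exists 0, S, 0; split=> //; [exact: psd0|rewrite !subr0 oppr0 sub0r].
have K2 T : psd T -> K (0, - T).
  by move=> hT; exists 0, 0, T; split=> //; [exact: psd0|rewrite !subr0 oppr0 sub0r].
have K3 s : F s -> K (s, - s).
  move=> Fs; exists s, 0, 0; split; rewrite ?subr0 //; try exact: psd0.
  exact: cone_mem.
(* [Q] collects the coefficients of [e] in all later errors: [3 + 4 dot x x] from the separation,
   the rest from the shifts added to [B]. The choice of [e] then ensures [e * Q < d]. *)
pose Q := 3 + 4 * dot x x + w * (3 + 2 * (n * n)%:R).
have Q3 : 3 <= Q.
  rewrite /Q -addrA lerDl; apply: addr_ge0; apply: mulr_ge0 => //.
  by apply: addr_ge0; exact: hsdotxx_ge0.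
pose e := d / (d + Q).
have dQ : 0 < d + Q by lra.
have e01 : 0 < e <= 1.
  rewrite divr_gt0 //= ler_pdivrMr // mul1r lerDl; lra.
have [||||||||y] := @approx_separation R V dot K x d _ _ _ _ _ _ _ _ e e01.
- by move=> u v z; rewrite /dot /= !hsdotDl addrACA.
- by move=> u v; rewrite /dot hsdotC (hsdotC u.2).
- by move=> t u v; rewrite /dot /= !hsdotZl mulrDr.
- by move=> u; apply: addr_ge0; exact: hsdotxx_ge0.
- by have := K1 0 (@psd0 R n); rewrite oppr0.
- move=> _ _ [s [S [T [cs hS hT ->]]]] [s' [S' [T' [cs' hS' hT' ->]]]].
  exists (s + s'), (S + S'), (T + T'); split; [exact: coneD|exact: psdD..|].
  by congr (_, _); rewrite /= !opprD addrACA.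
- move=> t _ t0 [s [S [T [cs hS hT ->]]]].
  exists (t%:C *: s), (t%:C *: S), (t%:C *: T).
  split; [exact: coneZ|by apply: psdZ; rewrite ?ler0c..|].
  by congr (_, _); rewrite /= scalerBr ?scalerN.
- by move=> _ [s [S [T [cs hS hT ->]]]]; exact: hd.
case=> [[s [S [T [[mu [s1 Fs1 [mu0 es]]] hS hT ey]]]] hK hx].
have hs : psd s by rewrite es; apply: psdZ; [rewrite ler0c|case: (dF s1 Fs1)].
pose f1 := rho - (s - S); pose f2 := - (w%:C *: rho) - (- s - T).
have fE z : dot (x - y) z = hsdot f1 z.1 + hsdot f2 z.2 by rewrite ey.
have hsN (X Y : 'M[C]_n) : hsdot X (- Y) = - hsdot X Y.
  by rewrite hsdotC -[- Y]sub0r hsdotBl (hsdotC Y) /hsdot mul0mx mxtrace0 sub0r.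
have hs0 (X : 'M[C]_n) : hsdot X 0 = 0 by rewrite hsdotC /hsdot mul0mx mxtrace0.
have adjB (X Y : 'M[C]_n) : X ^t* = X -> Y ^t* = Y -> (X - Y) ^t* = X - Y.
  by move=> hX hY; rewrite linearB /= map_mxB hX hY.
have adjN (X : 'M[C]_n) : X ^t* = X -> (- X) ^t* = - X.
  by move=> hX; rewrite linearN /= map_mxN hX.
have hwr : psd (w%:C *: rho) by apply: psdZ; rewrite ?ler0c.
have f1adj : f1 ^t* = f1 by rewrite adjB // ?adjB // psd_adj.
have f2adj : f2 ^t* = f2 by rewrite adjB // ?adjB // ?adjN // psd_adj.
(* Cone elements [(- S, 0)] show that [f1] is almost nonnegative; [(0, - T)] do the same for
   [f2]. *)
have hA : psd (f1 + (2 * e)%:C *: 1%:M).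
  apply: psd_shift => // S' hS'; have := hK _ (K1 S' hS').
  by rewrite fE /dot /= hs0 hsN hsdotNN hs0; lra.
have hB : psd (f2 + (2 * e)%:C *: 1%:M).
  apply: psd_shift => // S' hS'; have := hK _ (K2 S' hS').
  by rewrite fE /dot /= hs0 hsN hsdotNN hs0; lra.
(* On [(s, - s)] with [s] free the separation yields [hsdot f1 s - hsdot f2 s <= c], so adding [c]
   to the second effect gives domination on [F]. *)
pose c := e * (1 + 2 * (n * n)%:R).
have e0 : 0 < e by case/andP: e01.
have c0 : 0 <= c by rewrite mulr_ge0 ?(ltW e0) // addr_ge0 // mulr_ge0.
have hB' : psd (f2 + (2 * e)%:C *: 1%:M + c%:C *: 1%:M).
  by apply: psdD => //; apply: psdZ; [rewrite ler0c|exact: psd1].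
have trE (H s' : 'M[C]_n) (k : R) : density s' ->
    complex.Re (\tr ((H + k%:C *: 1%:M) *m s')) = complex.Re (\tr (H *m s')) + k.
  move=> [_ ts']; rewrite mulmxDl mxtraceD -scalemxAl mul1mx mxtraceZ ts' mulr1.
  by rewrite raddfD.
have eA s' : density s' ->
    complex.Re (\tr ((f1 + (2 * e)%:C *: 1%:M) *m s')) = hsdot f1 s' + 2 * e.
  by move=> ds'; rewrite trE // hsdot_psd //; case: ds'.
have eB s' : density s' ->
    complex.Re (\tr ((f2 + (2 * e)%:C *: 1%:M + c%:C *: 1%:M) *m s')) =
    hsdot f2 s' + 2 * e + c.
  by move=> ds'; rewrite !trE // hsdot_psd //; case: ds'.
move: (f1 + _) hA eA => A hA eA.
move: (f2 + _ + _) hB' eB => B hB' eB.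
exists A, B; split; [exact: hA|exact: hB'| |].
  move=> s' Fs'; have ds' := dF s' Fs'; have [hs' _] := ds'.
  rewrite (Re_psd_tr hA hs') (Re_psd_tr hB' hs') lecR (eA s' ds') (eB s' ds').
  have h2 := hK _ (K3 s' Fs'); rewrite fE /dot /= hsN hsdotNN in h2.
  have h1 := hsdot_density ds'.
  have h3 : e * hsdot s' s' <= e * (n * n)%:R by rewrite ler_pM2l.
  by move: h2 h3; rewrite /c; clear; lra.
rewrite (Re_psd_tr hA hr) (Re_psd_tr hB' hr) -rmorphM ltcR (eA rho dr) (eB rho dr).
move: hx; rewrite fE /= hsN (hsdotC f2) hsdotZl (hsdotC rho) => hx.
have eQ : e * Q < d.
  by rewrite /e mulrAC ltr_pdivrMr // ltr_pM2l // ltrDr.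
move: hx eQ e0; rewrite /Q /c; clear; lra.
Qed.

End Witness.

(** * From dual witnesses to transformations *)

Section Transformations.
Variable R : realType.
Local Notation C := (R[i]).
Local Notation "x %:C" := (real_complex R x) (format "x %:C").

(** Adding [t] times the identity to [B] preserves domination on [F]. The value [t = a / w - b]
    turns the strict inequality at [rho] into an equality, and being positive it makes the trace
    against [B] positive. *)
Lemma Omega_F_dual_eq n (F : set 'M[C]_n) (rho : 'M[C]_n) (w : R) :
  free_set F -> density rho -> 0 < w -> (w%:E < Omega_F F rho)%E ->
  exists A B, exists2 b : R, 0 < b &
    [/\ psd A, psd B, forall s, F s -> \tr (A *m s) <= \tr (B *m s) &
        \tr (B *m rho) = b%:C /\ \tr (A *m rho) = (w * b)%:C].
Proof.
move=> fF dr w0 hw; have [A [B [hA hB hF h]]] := Omega_F_dual fF dr (ltW w0) hw.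
have [hr tr] := dr.
pose a := complex.Re (\tr (A *m rho)); pose b := complex.Re (\tr (B *m rho)).
have ea : \tr (A *m rho) = a%:C by exact: Re_psd_tr.
have eb : \tr (B *m rho) = b%:C by exact: Re_psd_tr.
have b0 : 0 <= b by rewrite -ler0c -eb psd_tr_mul_ge0.
have lt : w * b < a by move: h; rewrite ea eb -rmorphM ltcR.
pose t := a / w - b.
have t0 : 0 < t by rewrite subr_gt0 ltr_pdivlMr // mulrC.
have trE s : \tr ((B + t%:C *: 1%:M) *m s) = \tr (B *m s) + t%:C * \tr s.
  by rewrite mulmxDl mxtraceD -scalemxAl mul1mx mxtraceZ.
have t0C : 0 <= t%:C :> C by rewrite ler0c ltW.
exists A, (B + t%:C *: 1%:M), (b + t); first lra.
split=> //.
- by apply: psdD => //; apply: psdZ => //; exact: psd1.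
- move=> s Fs; rewrite trE; apply: le_trans (hF s Fs) _.
  have [_ /(_ s Fs)[_ ->] _ _] := fF.
  by rewrite mulr1 lerDl.
- have -> : w * (b + t) = a by rewrite /t; field; rewrite gt_eqF.
  by rewrite trE tr mulr1 eb (rmorphD _ b t) ea.
Qed.

Lemma cone_psd n (F : set 'M[C]_n) X : (forall s, F s -> density s) ->
  cone F X -> psd X.
Proof.
move=> dF [mu [s /dF[hs _] [mu0 ->]]]; apply: psdZ => //.
by rewrite ler0c.
Qed.

(* The output on a free state with [tr (A s) = a <= b = tr (B s)] is
   [(b - a) (l sigma' - rho') + a (l - k) sigma'], and on [rho], where
   [a = w b], it is proportional to [(w - 1) rho' + (l - w k) sigma']. *)
Lemma dual_transformation n m (F : set 'M[C]_n) (F' : set 'M[C]_m)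
    (rho : 'M[C]_n) (rho' sigma' : 'M[C]_m) (w l k eps : R) :
  free_set F -> free_set F' -> density rho -> density rho' -> F' sigma' ->
  1 < w -> (w%:E < Omega_F F rho)%E -> k <= l ->
  psd (rho' - k%:C *: sigma') -> cone F' (l%:C *: sigma' - rho') ->
  0 <= l - w * k -> 2 * (l - w * k) < eps * (w - 1) ->
  exists E : {linear 'M[C]_n -> 'M[C]_m},
    [/\ RNG F F' E, 0 < \tr (E rho) &
      mx_close ((\tr (E rho))^-1 *: E rho) rho' eps].
Proof.
move=> fF fF' dr dr' Fs' w1 hw kl hP cQ g0 geps.
have [_ dF _ _] := fF; have [_ dF' _ coF'] := fF'.
have w0 : 0 < w by apply: lt_trans w1.
have [A [B [b b0 [hA hB hAB [eb ea]]]]] := Omega_F_dual_eq fF dr w0 hw.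
have hQ := cone_psd dF' cQ.
pose P := rho' - k%:C *: sigma'; pose Q := l%:C *: sigma' - rho'.
pose g := l - w * k.
have dd : 0 < w - 1 + g by rewrite ltr_wpDr // subr_gt0.
have eE : measure_prepare A B P Q rho =
    b%:C *: ((w - 1)%:C *: rho' + g%:C *: sigma').
  rewrite /measure_prepare ea eb /P /Q /g; apply/matrixP => i j; rewrite !mxE.
  by rewrite !(rmorphB, rmorphM, rmorph1) /=; ring.
have [hs' ts'] := dF' _ Fs'; have [hr' tr'] := dr'.
have tE : \tr (measure_prepare A B P Q rho) = (b * (w - 1 + g))%:C.
  by rewrite eE mxtraceZ mxtraceD !mxtraceZ ts' tr' !mulr1 -rmorphD -rmorphM.
have [||E [hE tE0 nE]] := @measure_prepare_RNG R n m F F' A B P Q rho dF dF' hA hB hP hQ.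
- move=> s Fs; have [hs _] := dF s Fs.
  have ras := Re_psd_tr hA hs; have rbs := Re_psd_tr hB hs.
  have le := hAB s Fs; have p := psd_tr_mul_ge0 hA hs.
  rewrite /measure_prepare ras rbs; rewrite ras rbs lecR in le.
  rewrite ras ler0c in p; move: le p {ras rbs}.
  move: (complex.Re (\tr (A *m s))) (complex.Re (\tr (B *m s))) => a' b' le p.
  have -> : a'%:C *: P + b'%:C *: Q =
      (b' - a')%:C *: Q + (a' * (l - k))%:C *: sigma'.
    rewrite /P /Q; apply/matrixP => i j; rewrite !mxE.
    by rewrite !(rmorphB, rmorphM) /=; ring.
  apply: coneD => //; first by apply: coneZ => //; rewrite subr_ge0.
  apply: coneZ; last exact: cone_mem.
  by rewrite mulr_ge0 // subr_ge0.
- by rewrite tE ltcR mulr_gt0.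
exists E; split=> //; rewrite nE tE eE => i j.
(* The normalized output is a convex combination of [rho'] and [sigma'], so its deviation from
   [rho'] carries the weight of [sigma']; the difference of two states has entries of modulus at
   most 2. *)
have -> : (((b * (w - 1 + g))%:C)^-1 *:
    (b%:C *: ((w - 1)%:C *: rho' + g%:C *: sigma'))) i j - rho' i j =
    (g / (w - 1 + g))%:C * (sigma' i j - rho' i j).
  have h1 : b%:C != 0 :> C by rewrite (inj_eq (@complexI R) b 0) gt_eqF.
  have h2 : (w - 1)%:C + g%:C != 0 :> C.
    by rewrite -rmorphD (inj_eq (@complexI R) _ 0) gt_eqF.
  rewrite !mxE (rmorphM _ b) (rmorphM _ g) fmorphV (rmorphD _ (w - 1) g) /=.
  move: ((w - 1)%:C) (g%:C) (b%:C) (rho' i j) (sigma' i j) h1 h2.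
  by move=> x y z p q h1 h2; field; rewrite h1 h2.
have gd0 : 0 <= g / (w - 1 + g) by rewrite divr_ge0 // ltW.
rewrite normrM ger0_norm ?ler0c //.
apply: (@le_lt_trans _ _ ((g / (w - 1 + g))%:C * 2%:R)).
  rewrite ler_wpM2l ?ler0c // (le_trans (ler_normB _ _)) //.
  rewrite mulr2n; apply: lerD; first by rewrite -ts' psd_entry_le.
  by rewrite -tr' psd_entry_le.
rewrite -(rmorph_nat (real_complex R)) -rmorphM ltcR mulrAC ltr_pdivrMr //.
have e0 : 0 <= eps.
  have : 0 < eps * (w - 1) by apply: le_lt_trans geps; rewrite mulr_ge0.
  by rewrite pmulr_lgt0 ?subr_gt0 // => /ltW.
have hg : 0 <= eps * g by rewrite mulr_ge0.
move: geps hg; rewrite -/g; move: (g) => g'; clear; lra.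
Qed.

Lemma RmaxF_lt n (F : set 'M[C]_n) (rho s : 'M[C]_n) (z : \bar R) :
  (RmaxF F rho s < z)%E -> exists2 l : R, cone F (l%:C *: s - rho) & (l%:E < z)%E.
Proof. by move=> /ereal_inf_lt[_ [l hl <-] lz]; exists l. Qed.

Lemma Rmax_lt n (rho s : 'M[C]_n) (z : \bar R) :
  (Rmax rho s < z)%E -> exists2 l : R, psd (l%:C *: s - rho) & (l%:E < z)%E.
Proof. by move=> /ereal_inf_lt[_ [l hl <-] lz]; exists l. Qed.

Lemma psd_scale_ge1 n (rho s : 'M[C]_n) (l : R) : density rho -> density s ->
  psd (l%:C *: s - rho) -> 1 <= l.
Proof.
by move=> dr ds /Rmax_le h; have := le_trans (Rmax_ge1 dr ds) h; rewrite lee_fin.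
Qed.

Lemma RmaxF_ge1 n (F : set 'M[C]_n) (rho s : 'M[C]_n) :
  (forall s, F s -> density s) -> density rho -> density s ->
  (1%:E <= RmaxF F rho s)%E.
Proof.
move=> dF dr ds; apply: le_ereal_inf_tmp => _ [l /= hl <-].
rewrite lee_fin; apply: (psd_scale_ge1 dr ds); exact: cone_psd hl.
Qed.

(** With both factors at least 1, an infinite one would make the product infinite. *)
Lemma ge1_lt_divr (x y : \bar R) (z : R) : (1%:E <= x)%E -> (1%:E <= y)%E ->
  (x * y < z%:E)%E -> exists2 r : R, 1 <= r & y = r%:E /\ (x < (z / r)%:E)%E.
Proof.
case: x => [x| |] //; case: y => [y| |] //; rewrite ?lee_fin => x1 y1.
- rewrite -EFinM lte_fin => h; exists y => //; split=> //.
  by rewrite lte_fin ltr_pdivlMr // (lt_le_trans _ y1).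
- by rewrite gt0_muley ?lte_fin ?(lt_le_trans _ x1).
- by rewrite gt0_mulye ?lte_fin ?(lt_le_trans _ y1).
Qed.

Lemma Omega_FF_lt n (F : set 'M[C]_n) (rho : 'M[C]_n) (z : R) :
  (forall s, F s -> density s) -> density rho -> (Omega_FF F rho < z%:E)%E ->
  exists s l mu, [/\ F s, 1 <= l, 1 <= mu & l * mu < z] /\
    cone F (l%:C *: s - rho) /\ psd (mu%:C *: rho - s).
Proof.
move=> dF dr /ereal_inf_lt[_ [s Fs <-] lz]; have ds := dF s Fs.
have [r r1 [er hl]] := ge1_lt_divr (RmaxF_ge1 dF dr ds) (Rmax_ge1 ds dr) lz.
have [l cl] := RmaxF_lt hl; rewrite lte_fin => lr.
have l1 : 1 <= l by apply: (psd_scale_ge1 dr ds); exact: cone_psd cl.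
have rp : 0 < r by apply: lt_le_trans r1.
have lp : 0 < l by apply: lt_le_trans l1.
(* The multipliers are chosen in turn: [l < z / r] leaves room for some [mu] with [l * mu < z]. *)
have [mu hmu] : exists2 mu : R, psd (mu%:C *: rho - s) & (mu%:E < (z / l)%:E)%E.
  by apply: Rmax_lt; rewrite er lte_fin ltr_pdivlMr // mulrC -ltr_pdivlMr.
rewrite lte_fin ltr_pdivlMr // mulrC => hm.
exists s, l, mu; split=> //; split=> //; exact: (psd_scale_ge1 ds dr hmu).
Qed.

Lemma Omega_F_ge1 n (F : set 'M[C]_n) (rho : 'M[C]_n) :
  (forall s, F s -> density s) -> density rho -> (1%:E <= Omega_F F rho)%E.
Proof.
move=> dF dr; apply: le_ereal_inf_tmp => _ [s Fs <-]; have ds := dF s Fs.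
have -> : 1%:E = (1%:E * 1%:E)%E :> \bar R by rewrite mule1.
by apply: lee_pmul; rewrite ?lee_fin // Rmax_ge1.
Qed.

End Transformations.

(** * The three sufficient conditions *)

Section Cases.
Variable R : realType.
Local Notation C := (R[i]).
Local Notation "x %:C" := (real_complex R x) (format "x %:C").

(** The input is discarded and [sigma'] prepared. This serves when [Omega_F F rho = 1], where no [w]
    lies strictly between 1 and [Omega_F F rho]. *)
Lemma const_transformation n m (F : set 'M[C]_n) (F' : set 'M[C]_m)
    (rho : 'M[C]_n) (rho' sigma' : 'M[C]_m) (eps : R) :
  free_set F -> free_set F' -> density rho -> F' sigma' ->
  mx_close sigma' rho' eps ->
  exists E : {linear 'M[C]_n -> 'M[C]_m},
    [/\ RNG F F' E, 0 < \tr (E rho) &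
      mx_close ((\tr (E rho))^-1 *: E rho) rho' eps].
Proof.
move=> [_ dF _ _] [_ dF' _ _] [_ tr] Fs' hc; have [hs' ts'] := dF' _ Fs'.
have eE X : measure_prepare 1%:M 0 sigma' 0 X = \tr X *: sigma'.
  by rewrite /measure_prepare mul1mx scaler0 addr0.
have [||E [hE E0 nE]] := @measure_prepare_RNG R n m F F' 1%:M 0 sigma' 0 rho dF
  dF' (@psd1 R n) (@psd0 R n) hs' (@psd0 R m).
- by move=> s /dF[_ ts]; rewrite eE ts scale1r; exact: cone_mem.
- by rewrite eE tr scale1r ts'.
by exists E; split=> //; rewrite nE eE tr scale1r ts' invr1 scale1r.
Qed.

Lemma transformation_finite n m (F : set 'M[C]_n) (F' : set 'M[C]_m)
    (rho : 'M[C]_n) (rho' : 'M[C]_m) :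
  free_set F -> free_set F' -> density rho -> density rho' ->
  (Omega_F F rho < +oo)%E -> (Omega_FF F' rho' <= Omega_F F rho)%E ->
  prob_transformation F F' rho rho'.
Proof.
move=> fF fF' dr dr' fin le eps eps0.
have [_ dF _ _] := fF; have [_ dF' _ coF'] := fF'.
move: (Omega_F_ge1 dF dr) fin le; case eO: (Omega_F F rho) => [w0| |] //.
rewrite lee_fin => w01 _ le.
have [e1|n1] := eqVneq w0 1.
  have eps2 : 0 < eps / 2 by rewrite divr_gt0.
  have lt : (Omega_FF F' rho' < (1 + eps / 2)%:E)%E.
    by apply: le_lt_trans le _; rewrite e1 lte_fin ltrDl.
  have [s [l [mu [[Fs l1 mu1 lm] [cl _]]]]] := Omega_FF_lt dF' dr' lt.
  apply: (const_transformation fF fF' dr Fs) => i j.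
  have [hs ts] := dF' s Fs; have [hr' tr'] := dr'.
  have ltl : l - 1 < eps / 2.
    have : l <= l * mu by rewrite ler_peMr // (le_trans _ l1).
    lra.
  have hQ := cone_psd dF' cl.
  (* The first matrix is semidefinite of trace [l - 1], so each term has modulus at most [l - 1]. *)
  have -> : s i j - rho' i j = (l%:C *: s - rho') i j - (l - 1)%:C * s i j.
    by rewrite !mxE rmorphB /=; ring.
  apply: (@le_lt_trans _ _ ((l - 1)%:C + (l - 1)%:C)); last first.
    by rewrite -rmorphD ltcR; lra.
  have l10 : 0 <= l - 1 by rewrite subr_ge0.
  apply: le_trans (ler_normB _ _) _; apply: lerD.
    apply: le_trans (psd_entry_le _ _ hQ) _.
    by rewrite raddfB /= mxtraceZ ts tr' mulr1 rmorphB.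
  rewrite normrM ger0_norm ?ler0c // ler_piMr ?ler0c // -ts.
  exact: psd_entry_le.
have w1 : 0 < w0 - 1 by rewrite subr_gt0 lt_def n1.
(* The bound 1/2 keeps [w - 1] above half of [w0 - 1]; the bound [eps / 16] makes the final error
   [4 h] smaller than [eps * (w - 1)]. *)
pose r : R := Num.min (1 / 2) (eps / 16).
have r0 : 0 < r by rewrite lt_min !divr_gt0.
have r2 : r <= 1 / 2 by rewrite ge_min lexx.
have r16 : r <= eps / 16 by rewrite ge_min lexx orbT.
pose h := r * (w0 - 1).
have h0 : 0 < h by rewrite mulr_gt0.
have h2 : h <= 1 / 2 * (w0 - 1) by rewrite ler_pM2r.
have h16 : h <= eps / 16 * (w0 - 1) by rewrite ler_pM2r.
have lt : (Omega_FF F' rho' < (w0 + h)%:E)%E.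
  by apply: le_lt_trans le _; rewrite lte_fin ltrDl.
have [s [l [mu [[Fs l1 mu1 lm] [cl hmu]]]]] := Omega_FF_lt dF' dr' lt.
pose w := w0 - h.
have mup : 0 < mu by apply: lt_le_trans mu1.
have k1 : mu^-1 <= 1 by rewrite invf_le1.
have k0 : 0 < mu^-1 by rewrite invr_gt0.
(* [l * mu] may fall below [w]; raising [l] keeps the weight of the free state nonnegative, and the
   extra multiple of [s] stays in the cone. *)
pose l' := Num.max l (w / mu).
have ll' : l <= l' by rewrite le_max lexx.
have wl' : 0 <= l' - w * mu^-1 by rewrite subr_ge0 le_max lexx orbT.
have ub : l' - w * mu^-1 <= 2 * h.
  rewrite lerBlDr ge_max; apply/andP; split; last by rewrite lerDr mulr_ge0 // ltW.
  have : l <= (w0 + h) * mu^-1 by rewrite ler_pdivlMr // ltW.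
  have : 2 * h * mu^-1 <= 2 * h * 1 by rewrite ler_pM2l // mulr_gt0.
  by rewrite /w; clear; lra.
apply: (dual_transformation (w := w) (l := l') (k := mu^-1) fF fF' dr dr' Fs).
- by rewrite /w; move: h2 w1 {r16 h16}; clear; lra.
- by rewrite eO lte_fin /w ltrBlDr ltrDl.
- exact: le_trans k1 (le_trans l1 ll').
- have -> : rho' - mu^-1%:C *: s = mu^-1%:C *: (mu%:C *: rho' - s).
    by rewrite scalerBr scalerA -rmorphM mulVf ?gt_eqF // rmorph1 scale1r.
  by apply: psdZ; rewrite ?ler0c ?ltW.
- have -> : l'%:C *: s - rho' = (l' - l)%:C *: s + (l%:C *: s - rho').
    by rewrite addrA -scalerDl -rmorphD subrK.
  apply: coneD => //; apply: coneZ; first by rewrite subr_ge0.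
  exact: cone_mem.
- exact: wl'.
- have hw : 1 / 2 * (w0 - 1) <= w - 1 by rewrite /w; move: h2; clear; lra.
  have : eps * (1 / 2 * (w0 - 1)) <= eps * (w - 1) by rewrite ler_pM2l.
  have : 0 < eps * (w0 - 1) by rewrite mulr_gt0.
  move: ub h16; clear; lra.
Qed.

Lemma transformation_infinite n m (F : set 'M[C]_n) (F' : set 'M[C]_m)
    (rho : 'M[C]_n) (rho' : 'M[C]_m) :
  free_set F -> free_set F' -> density rho -> density rho' ->
  Omega_F F rho = +oo%E -> (R_FF F' rho' < +oo)%E ->
  prob_transformation F F' rho rho'.
Proof.
move=> fF fF' dr dr' eO /ereal_inf_lt[_ [s Fs <-] /RmaxF_lt[l cl _]] eps eps0.
have [_ dF' _ _] := fF'.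
have l1 : 1 <= l by apply: (psd_scale_ge1 dr' (dF' s Fs)); exact: cone_psd cl.
have l0 : 0 < l by apply: lt_le_trans l1.
(* Every [w] is available here; this one makes [eps * (w - 1) = 2 * l + 1], just above twice the
   weight [l] of the free state. Taking [k = 0] prepares [rho'] itself. *)
apply: (dual_transformation (w := 1 + (2 * l + 1) / eps) (l := l) (k := 0)
  fF fF' dr dr' Fs).
- by rewrite ltrDl divr_gt0 // addr_gt0 // mulr_gt0.
- by rewrite eO ltry.
- exact: ltW.
- by rewrite scale0r subr0; case: dr'.
- exact: cl.
- by rewrite mulr0 subr0 ltW.
- by rewrite mulr0 subr0 addrAC subrr add0r mulrCA mulfV ?gt_eqF // mulr1 ltrDl.
Qed.

(** Take [s0] of maximal rank in [F]. Its average [tau] with [s] has as kernel the intersection of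
    both kernels, so the row space of [tau] contains that of [s0]; by maximality they agree. *)
Lemma max_support n (F : set 'M[C]_n) : free_set F ->
  exists2 s0, F s0 & forall s (v : 'cV[C]_n), F s -> s0 *m v = 0 -> s *m v = 0.
Proof.
move=> [[sF FsF] dF _ coF].
pose P (k : nat) := `[< exists2 s, F s & \rank s = k >].
have exP : exists k, P k by exists (\rank sF); apply/asboolP; exists sF.
have ubP k : P k -> (k <= n)%N by move=> /asboolP[s _ <-]; exact: rank_leq_row.
case: (ex_maxnP exP ubP) => k /asboolP[s0 Fs0 ek] kmax.
exists s0 => // s v Fs s0v.
pose tau := (1 / 2)%:C *: s + (1 - 1 / 2)%:C *: s0.
have Ft : F tau by apply: coF => //; apply/andP; split; lra.
have p1 : 0 < (1 / 2)%:C :> C by rewrite ltcR; lra.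
have p2 : 0 < (1 - 1 / 2)%:C :> C by rewrite ltcR; lra.
have [hs _] := dF s Fs; have [hs0 _] := dF s0 Fs0.
have ker (u : 'cV[C]_n) : tau *m u = 0 -> s *m u = 0 /\ s0 *m u = 0.
  move=> tu; have : sform tau u u = 0 by rewrite /sform -mulmxA tu mulmx0 mxE.
  have q1 : 0 <= sform s u u by move/psdP: hs.
  have q2 : 0 <= sform s0 u u by move/psdP: hs0.
  rewrite sformD !sformZ => /eqP.
  rewrite paddr_eq0 ?mulr_ge0 ?(ltW p1) ?(ltW p2) //.
  rewrite !mulf_eq0 (gt_eqF p1) (gt_eqF p2) /= => /andP[/eqP e1 /eqP e2].
  by split; apply: psd_sform0.
have s0t : (s0 <= tau)%MS by apply: submx_ker => u /ker[].
have ts0 : (tau <= s0)%MS.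
  rewrite -(mxrank_leqif_sup s0t) eqn_leq mxrankS //= ek.
  by apply: kmax; apply/asboolP; exists tau.
have /submxP[D eD] := ts0.
by have [] := ker v; rewrite // eD -mulmxA s0v mulmx0.
Qed.

Lemma transformation_unsupported n m (F : set 'M[C]_n) (F' : set 'M[C]_m)
    (rho : 'M[C]_n) (rho' : 'M[C]_m) :
  free_set F -> free_set F' -> density rho -> density rho' ->
  R_F F rho = +oo%E -> prob_transformation F F' rho rho'.
Proof.
move=> fF fF' dr dr' eR eps eps0.
have [_ dF _ _] := fF; have [[sF' FsF'] dF' _ _] := fF'.
have [hr tr] := dr; have [hr' tr'] := dr'.
have [s0 Fs0 hmax] := max_support fF; have [hs0 _] := dF s0 Fs0.
(* Otherwise the kernel of [s0] lies in that of [rho], so some multiple of [s0] dominates [rho] and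
   [R_F F rho] is finite. *)
have [v s0v rv] : exists2 v : 'cV[C]_n, s0 *m v = 0 & rho *m v <> 0.
  apply: contrapT => H.
  have [l l0 hl] : exists2 l : R, 0 <= l & psd (l%:C *: s0 - rho).
    apply: psd_ker_dominated => // v s0v; apply: contrapT => rv.
    by apply: H; exists v.
  have : (R_F F rho <= l%:E)%E.
    by apply: le_trans (Rmax_le hl); apply: ereal_inf_lbound; exists s0.
  by rewrite eR leye_eq.
have trE X : \tr (v *m v ^t* *m X) = sform X v v by rewrite mxtrace_mulC -sform_tr.
have q0 : 0 < sform rho v v.
  rewrite lt_def; apply/andP; split; last by move/psdP: hr.
  by apply/eqP => /(psd_sform0 hr).
have eE X : measure_prepare (v *m v ^t* ) 0 rho' 0 X = sform X v v *: rho'.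
  by rewrite /measure_prepare trE scaler0 addr0.
have [||E [hE E0 nE]] := @measure_prepare_RNG R n m F F' (v *m v ^t* ) 0 rho' 0 rho
  dF dF' (psd_outer v) (@psd0 R n) hr' (@psd0 R m).
- move=> s Fs; rewrite eE /sform -mulmxA (hmax s v Fs s0v) mulmx0 mxE scale0r.
  by exists 0, sF' => //; rewrite scale0r.
- by rewrite eE mxtraceZ tr' mulr1.
exists E; split=> //; rewrite nE eE mxtraceZ tr' mulr1 scalerA mulVf ?gt_eqF //.
by move=> i j; rewrite scale1r subrr normr0 ltcR.
Qed.

End Cases.

Theorem theorem4 (R : realType) (n m : nat)
    (F : set 'M[R[i]]_n) (F' : set 'M[R[i]]_m)
    (rho : 'M[R[i]]_n) (rho' : 'M[R[i]]_m) :
  free_set F -> free_set F' -> density rho -> density rho' ->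
  [\/ (Omega_F F rho < +oo)%E /\ (Omega_FF F' rho' <= Omega_F F rho)%E,
      Omega_F F rho = +oo%E /\ (R_FF F' rho' < +oo)%E
    | R_F F rho = +oo%E ] ->
  prob_transformation F F' rho rho'.
Proof.
move=> fF fF' dr dr' [[h1 h2]|[h1 h2]|h].
- exact: transformation_finite.
- exact: transformation_infinite.
- exact: transformation_unsupported.
Qed.
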